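(* Let $(\bar x,\bar u)$ be a weak local minimizer of problem (P) and suppose there exist $\varepsilon>0$, $\delta>0$ and $(y,v)\in W^{1,1}([0,1];\mathbb R^n)\times L^\infty([0,1];\mathbb R^m)$ solving the linear system $$\dot y(t)=\bar f_x(t)y(t)+\bar f_u(t)v(t)\ \text{ a.e.},\qquad y(0)=0,$$ and satisfying $$\bar g_x(t)y(t)+\bar g_u(t)v(t)\le-\delta\qquad\text{for a.e. }t\in\{\bar g\ge-\varepsilon\}.$$ Then every multiplier tuple $(\lambda,\beta,\lambda_0,z,\zeta)$ for (P) at $(\bar x,\bar u)$ fulfills $\lambda_0>0$ together with the bound $$\|z\|_{L^1}+\zeta([0,1])\ \le\ \frac{\lambda_0}{\delta}\int_0^1\bigl|\bar L_x(t)y(t)+\bar L_u(t)v(t)\bigr|\,dt .$$ In particular, the set of all multiplier tuples satisfying $\lambda_0=1$ is bounded (in $BV([0,1];\mathbb R^n)\times BV([0,1];\mathbb R^n)\times\mathbb R\times L^1([0,1];\mathbb R)\times\operatorname{ba}$).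
   Context: Notation. $|\cdot|$ is the Euclidean norm; ''a.e.'' refers to Lebesgue measure $\mathrm{Leb}$; $\mathfrak L$ is the $\sigma$-algebra of Lebesgue measurable subsets of $[0,1]$. $BV([0,1];\mathbb R^n)$ denotes functions of bounded variation that are right-continuous on $(0,1)$. Problem (P): minimize $J(x,u)=\int_0^1L(t,x(t),u(t))\,dt$ over $(x,u)\in W^{1,1}([0,1];\mathbb R^n)\times L^\infty([0,1];\mathbb R^m)$ subject to $\dot x(t)=f(t,x(t),u(t))$ a.e., $g(t,x(t),u(t))\le 0$ a.e., $x(0)=x_0$, where $x_0\in\mathbb R^n$ is fixed and $(L,f,g):[0,1]\times\mathbb R^n\times\mathbb R^m\to\mathbb R\times\mathbb R^n\times\mathbb R$ are continuous in $(t,x,u)$ and continuously differentiable in $(x,u)$ (derivatives jointly continuous in $(t,x,u)$). Pairs satisfying the constraints are admissible processes. A weak local minimizer is an admissible $(\bar x,\bar u)$ for which there is $\varepsilon>0$ with $J(\bar x,\bar u)\le J(x,u)$ for all admissible $(x,u)$ with $\|x-\bar x\|_C<\varepsilon$, $\|u-\bar u\|_{L^\infty}<\varepsilon$. A bar denotes evaluation along $(\bar x,\bar u)$: $\bar k(t)=k(t,\bar x(t),\bar u(t))$; $\bar L_x,\bar L_u,\bar g_x,\bar g_u$ are row vectors and $\bar f_x,\bar f_u$ Jacobian matrices. $\{\bar g\ge-\varepsilon\}=\{t\in[0,1]:\bar g(t)\ge-\varepsilon\}$. Charges. A charge is a finitely additive set function on $\mathfrak L$ vanishing at $\emptyset$;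 $\operatorname{ba}$ denotes the bounded charges vanishing on Lebesgue null sets, with the total variation norm (isometric to $L^\infty([0,1];\mathbb R)^*$). A positive charge $\zeta$ is pure if the only countably additive measure $\mu$ with $0\le\mu\le\zeta$ is $\mu=0$. For $k\in L^\infty$, $\int_E k\,d\zeta$ is the limit of integrals of simple functions converging to $k\chi_E$ uniformly a.e. (componentwise for vectors). For $\zeta\ge0$, ''$k=0$ $\zeta$-a.e.'' means $\zeta(\{|k|>\varepsilon\})=0$ for all $\varepsilon>0$. Multiplier tuple for (P) at $(\bar x,\bar u)$: $(\lambda,\beta,\lambda_0,z,\zeta)$ with $\lambda_0\ge0$ a scalar, $z\in L^1([0,1];\mathbb R)$, $z\ge0$, $\zeta\in\operatorname{ba}$ a pure charge, $\zeta\ge0$, $\lambda,\beta\in BV([0,1];\mathbb R^n)$ such that: (a) $\lambda_0+\|z\|_{L^1}+\zeta([0,1])>0$; (b) $z(t)\bar g(t)=0$ a.e. and $\bar g=0$ $\zeta$-a.e.; (c) $\lambda(1)=\beta(1)=0$, $-d\lambda=[\bar f_x^T\lambda+\lambda_0\bar L_x^T+z\bar g_x^T]\,dt+d\beta$ (as measures on $[0,1]$), where $\beta(0)=-\int_0^1\bar g_x^T\,d\zeta$ and $\beta(t)=-\lim_{k\to\infty}\int_{t+1/k}^1\bar g_x^T\,d\zeta$ for $t\in(0,1)$; (d) $0=\bar f_u^T\lambda+\lambda_0\bar L_u^T+\bar g_u^Tz$ a.e., and $\int_E\bar g_u^T\,d\zeta=0$ for every $E\in\mathfrak L$. *)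

(* Defs.v *)
From HB Require Import structures.
From mathcomp Require Import all_boot all_order all_algebra.
From mathcomp Require Import all_classical all_reals all_analysis.

Set Implicit Arguments.
Unset Strict Implicit.
Unset Printing Implicit Defensive.

Import Order.TTheory GRing.Theory Num.Theory.
Import numFieldNormedType.Exports.
Import HBSimple.

Local Open Scope classical_set_scope.
Local Open Scope ring_scope.

(* The real line with the Lebesgue (i.e. Caratheodory) sigma-algebra; the plain
   type R carries the Borel sigma-algebra under the name measurableTypeR R. *)
Notation LebR R := (caratheodory_type (T := ocitv_type R) (wlength idfun)^*%mu).

Notation Leb := completed_lebesgue_measure.

Section Spaces.
Context {R : realType}.

(* Functions on [0,1] are represented by functions on R of which only the
   values on [0,1] matter. *)
Definition I01 : set (LebR R) := `[0, 1].

Definition ae01 (Q : R -> Prop) : Prop :=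
  {ae (@Leb R), forall t : LebR R, I01 t -> Q t}.

(* The library norm on matrices is the sup norm; this is the Euclidean one. *)
Definition enorm n (v : 'cV[R]_n) : R := Num.sqrt (\sum_i v i 0 ^+ 2).

Definition Linfty_norm n (u : R -> 'cV[R]_n) : \bar R :=
  Lnorm (@Leb R) +oo ((fun t : LebR R => (enorm (u t))%:E) \_ I01).

Definition Linfty n (u : R -> 'cV[R]_n) : Prop :=
  (forall i, measurable_fun I01 (fun t : LebR R => u t i 0)) /\
  (Linfty_norm u < +oo)%E.

Definition L1 (z : R -> R) : Prop :=
  (@Leb R).-integrable I01 (fun t : LebR R => (z t)%:E).

Definition L1_norm (z : R -> R) : \bar R :=
  (\int[@Leb R]_(t in I01) `|(z t)%:E|)%E.

(* x is (the continuous representative of) an element of W^{1,1} with derivative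
   w in L^1; w is determined up to a.e. equality. *)
Definition has_L1_derivative n (x w : R -> 'cV[R]_n) : Prop :=
  (forall i, L1 (fun t => w t i 0)) /\
  (forall t : R, 0 <= t <= 1 -> forall i,
     x t i 0 = x 0 i 0 + \int[@Leb R]_(s in `[0, t]) w s i 0).

(* x is in W^{1,1} and x' = h a.e. *)
Definition ode n (x h : R -> 'cV[R]_n) : Prop :=
  exists2 w, has_L1_derivative x w & ae01 (fun t => w t = h t).

Definition C_norm n (x : R -> 'cV[R]_n) : \bar R :=
  ereal_sup [set (enorm (x t))%:E | t in `[0, 1]].

Definition vvariation n (F : R -> 'cV[R]_n) : \bar R :=
  ereal_sup [set (\sum_(p <- zip (0 :: s) s) enorm (F p.2 - F p.1))%:E
            | s in itv_partition 0 1].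

Definition BV n (F : R -> 'cV[R]_n) : Prop :=
  (vvariation F < +oo)%E /\ (forall t : R, 0 < t < 1 -> F s @[s --> t^'+] --> F t).

Definition BV_norm n (F : R -> 'cV[R]_n) : \bar R :=
  ((enorm (F 0))%:E + vvariation F)%E.

(* nu is the Lebesgue-Stieltjes measure dF on [0,1] of a function F that is
   right-continuous on (0,1): the atoms at 0 and 1 are the jumps F(0+) - F(0)
   and F(1) - F(1-). *)
Definition stieltjes (F : R -> R) (nu : {charge set (measurableTypeR R) -> \bar R})
    : Prop :=
  forall t : R, 0 < t <= 1 -> nu `[0, t]%classic = (F t - F 0)%:E.

End Spaces.

Section Charges.
Context {R : realType}.

(* A set function on the Lebesgue measurable subsets of [0,1] that vanishes on
   null sets is represented by its extension A |-> zeta (A `&` [0,1]) to the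
   Lebesgue measurable subsets of R, whence the form of the nullity clause. *)
Definition ba (zeta : {additive_charge set (LebR R) -> \bar R}) : Prop :=
  (exists M : R, forall A, measurable A -> (`|zeta A| <= M%:E)%E) /\
  (forall A, measurable A -> @Leb R (A `&` I01) = 0%E -> zeta A = 0%E).

Definition ba_norm (zeta : {additive_charge set (LebR R) -> \bar R}) : \bar R :=
  ereal_sup [set v | exists k (E : 'I_k -> set (LebR R)),
    [/\ forall i, measurable (E i), forall i, E i `<=` I01, trivIset setT E
      & v = (\sum_i `|zeta (E i)|)%E]].

Definition positive_charge (zeta : {additive_charge set (LebR R) -> \bar R}) : Prop :=
  forall A, measurable A -> (0 <= zeta A)%E.

Definition pure_charge (zeta : {additive_charge set (LebR R) -> \bar R}) : Prop :=
  forall mu : {measure set (LebR R) -> \bar R},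
    (forall A, measurable A -> (mu A <= zeta A)%E) ->
    forall A, measurable A -> mu A = 0%E.

(* k only needs to be essentially bounded: the integral is the limit over simple
   functions converging to k 1_E in L^infty, and any two such sequences give the
   same limit when zeta is in ba. *)
Definition is_charge_integral (zeta : {additive_charge set (LebR R) -> \bar R})
    (E : set (LebR R)) (k : R -> R) (r : R) : Prop :=
  exists2 s : nat -> {sfun (LebR R) >-> R},
    Lnorm (@Leb R) +oo
      ((fun t : LebR R => (s j t - (k \_ E) t)%:E) \_ I01) @[j --> \oo] --> 0%E
  & sintegral zeta (s j) @[j --> \oo] --> r%:E.

Definition charge_integral zeta (E : set (LebR R)) (k : R -> R) : R :=
  get (is_charge_integral zeta E k).

Definition zero_charge_ae (zeta : {additive_charge set (LebR R) -> \bar R})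
    (k : R -> R) : Prop :=
  forall e : R, 0 < e -> zeta (I01 `&` [set t | e < `|k t|]) = 0%E.

End Charges.

Section Derivatives.
Context {R : realType}.

Definition jac p q (F : 'cV[R]_p -> 'cV[R]_q) (a : 'cV[R]_p) : 'M[R]_(q, p) :=
  \matrix_(i, j) ('D_(delta_mx j 0) F a) i 0.

Definition grad p (F : 'cV[R]_p -> R) (a : 'cV[R]_p) : 'rV[R]_p :=
  \row_j 'D_(delta_mx j 0) F a.

End Derivatives.

Record ocp (R : realType) (n m : nat) := OCP {
  cost : R -> 'cV[R]_n -> 'cV[R]_m -> R ;
  dyn  : R -> 'cV[R]_n -> 'cV[R]_m -> 'cV[R]_n ;
  cstr : R -> 'cV[R]_n -> 'cV[R]_m -> R ;
  init : 'cV[R]_n }.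

Section Problem.
Context {R : realType} {n m : nat}.
Implicit Types (P : ocp R n m) (x : R -> 'cV[R]_n) (u : R -> 'cV[R]_m).

Definition cost_x P t a b : 'rV[R]_n := grad (fun a' => cost P t a' b) a.
Definition cost_u P t a b : 'rV[R]_m := grad (fun b' => cost P t a b') b.
Definition cstr_x P t a b : 'rV[R]_n := grad (fun a' => cstr P t a' b) a.
Definition cstr_u P t a b : 'rV[R]_m := grad (fun b' => cstr P t a b') b.
Definition dyn_x P t a b : 'M[R]_n := jac (fun a' => dyn P t a' b) a.
Definition dyn_u P t a b : 'M[R]_(n, m) := jac (fun b' => dyn P t a b') b.

Definition jointly_continuous (T : topologicalType)
    (k : R -> 'cV[R]_n -> 'cV[R]_m -> T) : Prop :=
  {within [set p : R * 'cV[R]_n * 'cV[R]_m | 0 <= p.1.1 <= 1],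
    continuous (fun p => k p.1.1 p.1.2 p.2)}.

Definition differentiable_xu (V : normedModType R)
    (k : R -> 'cV[R]_n -> 'cV[R]_m -> V) : Prop :=
  forall t a b, 0 <= t <= 1 ->
    differentiable (fun p : 'cV[R]_n * 'cV[R]_m => k t p.1 p.2) (a, b).

Definition smooth_data P : Prop :=
  [/\ [/\ jointly_continuous (cost P), jointly_continuous (dyn P)
        & jointly_continuous (cstr P)],
      [/\ differentiable_xu (cost P), differentiable_xu (dyn P)
        & differentiable_xu (cstr P)],
      [/\ jointly_continuous (cost_x P), jointly_continuous (dyn_x P)
        & jointly_continuous (cstr_x P)]
    & [/\ jointly_continuous (cost_u P), jointly_continuous (dyn_u P)
        & jointly_continuous (cstr_u P)]].

Definition along T (k : R -> 'cV[R]_n -> 'cV[R]_m -> T) x u (t : R) : T :=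
  k t (x t) (u t).

Definition objective P x u : R := \int[@Leb R]_(t in I01) along (cost P) x u t.

Definition admissible P x u : Prop :=
  [/\ Linfty u, ode x (along (dyn P) x u),
      ae01 (fun t => along (cstr P) x u t <= 0) & x 0 = init P].

Definition weak_local_minimizer P x u : Prop :=
  admissible P x u /\
  exists2 e : R, 0 < e & forall x' u', admissible P x' u' ->
    (C_norm (fun t => (x' t - x t)%R) < e%:E)%E ->
    (Linfty_norm (fun t => (u' t - u t)%R) < e%:E)%E ->
    objective P x u <= objective P x' u'.

Record multiplier := Multiplier {
  lam : R -> 'cV[R]_n ;
  bet : R -> 'cV[R]_n ;
  lam0 : R ;
  mz : R -> R ;
  mzeta : {additive_charge set (LebR R) -> \bar R} }.

Definition multiplier_norm (w : multiplier) : \bar R :=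
  (BV_norm (lam w) + BV_norm (bet w) + `|lam0 w|%:E + L1_norm (mz w)
   + ba_norm (mzeta w))%E.

Definition adjoint_rate P x u (w : multiplier) (t : R) : 'cV[R]_n :=
  (along (dyn_x P) x u t)^T *m lam w t + lam0 w *: (along (cost_x P) x u t)^T
  + mz w t *: (along (cstr_x P) x u t)^T.

Definition adjoint_equation P x u (w : multiplier) : Prop :=
  forall i, exists dlam dbet : {charge set (measurableTypeR R) -> \bar R},
    [/\ stieltjes (fun t => lam w t i 0) dlam,
        stieltjes (fun t => bet w t i 0) dbet
      & forall A : set (measurableTypeR R), measurable A -> A `<=` `[0, 1] ->
          (- dlam A = \int[@Leb R]_(t in A) (adjoint_rate P x u w t i 0)%:E
                      + dbet A)%E].

Definition beta_formula P x u (w : multiplier) : Prop :=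
  forall i, let gi t := along (cstr_x P) x u t 0 i in
    bet w 0 i 0 = - charge_integral (mzeta w) I01 gi /\
    (forall t : R, 0 < t < 1 ->
       - charge_integral (mzeta w) `[t + k.+1%:R^-1, 1] gi @[k --> \oo]
         --> bet w t i 0).

Definition multiplier_tuple P x u (w : multiplier) : Prop :=
  [/\ [/\ 0 <= lam0 w, L1 (mz w), ae01 (fun t => 0 <= mz w t),
          BV (lam w) & BV (bet w)],
      [/\ ba (mzeta w), positive_charge (mzeta w) & pure_charge (mzeta w)],
      (0 < (lam0 w)%:E + L1_norm (mz w) + mzeta w I01)%E,
      ae01 (fun t => mz w t * along (cstr P) x u t = 0) /\
      zero_charge_ae (mzeta w) (along (cstr P) x u)
    & [/\ lam w 1 = 0 /\ bet w 1 = 0, adjoint_equation P x u w,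
          beta_formula P x u w,
          ae01 (fun t =>
            0 = (along (dyn_u P) x u t)^T *m lam w t
                + lam0 w *: (along (cost_u P) x u t)^T
                + mz w t *: (along (cstr_u P) x u t)^T)
        & forall (E : set (LebR R)) j, measurable E -> E `<=` I01 ->
            charge_integral (mzeta w) E (fun t => along (cstr_u P) x u t 0 j) = 0]].

End Problem.

(* Main.v *)
(* Since [lam + bet] is absolutely continuous with derivative minus the
   adjoint rate, integrating it against [y'] by parts turns the adjoint equation
   and the stationarity condition into
     [\int (gx y + gu v) dzeta + \int z (gx y + gu v) dt
        = - lam0 \int (Lx y + Lu v) dt],
   where [\int bet . y' dt = - \int gx y dzeta] is a Fubini identity for the
   charge and [\int gu v dzeta = 0].  By complementarity [z] and [zeta] live where
   [gx y + gu v <= - delta], hence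
     [delta (|z| + zeta[0,1]) <= lam0 \int |Lx y + Lu v| dt],
   and [lam0 = 0] would make the tuple trivial.  For [lam0 = 1] this bounds [z]
   and [zeta], then [bet], whose variation is at most [|gx| zeta[0,1]], and finally
   [lam] by Gronwall's inequality. *)
Require Import Defs.
From HB Require Import structures.
From mathcomp Require Import all_boot all_order all_algebra.
From mathcomp Require Import all_classical all_reals all_analysis.
From mathcomp Require Import measurable_realfun ess_sup_inf.
From mathcomp Require Import ring lra.

Set Implicit Arguments.
Unset Strict Implicit.
Unset Printing Implicit Defensive.

Import Order.TTheory GRing.Theory Num.Theory.
Import numFieldNormedType.Exports.
Import HBSimple.

Local Open Scope classical_set_scope.
Local Open Scope ring_scope.

(** * Lebesgue integration on the unit interval *)

(** The obstacle is that [zeta] is only finitely additive: neither Fubini's theorem nor dominated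
    convergence applies to it, while [lam] and [bet] may jump, so that it matters which endpoint
    belongs to an interval. The remedy is to forget the measures and keep what integrals with an L1
    density and charge integrals share: linearity on essentially bounded functions and domination by
    a monotone functional. One exchange lemma for such functionals, whose only analytic input is the
    absolute continuity of the integral of [y'], is applied once to [lam + bet] and once to [- bet];
    the sum pairs [lam] with [y']. The limit from the right in the formula for [beta] is harmless
    there, because a half-open cell [[a, b[] contains all points slightly to the right of each of
    its points. Charge integrals make sense only for essentially bounded measurable integrands,
    hence the preliminary work on the data along the process. Gronwall's inequality runs backwards
    from [t = 1], and its constant must not depend on the tuple. *)

Section Lebesgue01.
Context {R : realType}.
Implicit Types (h k : R -> R) (A : set R).

Lemma leb_measurable A :
  @measurable _ (measurableTypeR R) A -> @measurable _ (LebR R) A.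
Proof. exact: sub_caratheodory. Qed.

Lemma leb_measurable_itv (i : interval R) : @measurable _ (LebR R) [set` i].
Proof. by apply: leb_measurable; exact: measurable_itv. Qed.

Lemma measurable_I01 : measurable (@I01 R).
Proof. exact: leb_measurable_itv. Qed.

Lemma leb_measurable_fun A h : measurable A ->
  @measurable_fun _ _ (measurableTypeR R) (measurableTypeR R) A h ->
  @measurable_fun _ _ (LebR R) (measurableTypeR R) A h.
Proof. by move=> mA mh _ Y mY; apply: leb_measurable; exact: mh. Qed.

Lemma leb_itv (i : interval R) : @Leb R [set` i] = @lebesgue_measure R [set` i].
Proof. by []. Qed.

Lemma leb_I01 : @Leb R I01 = 1%E.
Proof. by rewrite /I01 leb_itv lebesgue_measure_itv /= lte01 oppr0 adde0. Qed.

(** [Lnorm] with exponent [+oo] is the essential supremum only on a space of positive measure; this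
    settles that test in [Linfty_le]. *)
Lemma leb_setT_gt0  : (0 < @Leb R setT)%E.
Proof.
apply: (@lt_le_trans _ _ (@Leb R I01)); first by rewrite leb_I01.
by apply: le_measure; rewrite ?inE//; exact: measurable_I01.
Qed.

Lemma I01P (t : R) : I01 t <-> 0 <= t <= 1.
Proof. by rewrite /I01/= in_itv. Qed.

Lemma ae01_and (P Q : R -> Prop) :
  ae01 P -> ae01 Q -> ae01 (fun t => P t /\ Q t).
Proof. by rewrite /ae01; apply: filterS2 => t Pt Qt It; split; auto. Qed.

Lemma ae01_imp (P Q : R -> Prop) :
  (forall t, 0 <= t <= 1 -> P t -> Q t) -> ae01 P -> ae01 Q.
Proof.
rewrite /ae01 => PQ; apply: filterS => t Pt It; apply: PQ; last exact: Pt.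
exact/I01P.
Qed.

Lemma ae01_all (P : R -> Prop) : (forall t, 0 <= t <= 1 -> P t) -> ae01 P.
Proof. by move=> H; apply/nearW => t /I01P It; apply: H. Qed.

Lemma ae01_neq (a : R) : ae01 (fun t => t != a).
Proof.
exists [set a]; split.
- by rewrite -set_itv1; exact: leb_measurable_itv.
- by rewrite -set_itv1 leb_itv set_itv1 lebesgue_measure_set1.
- by move=> t /= /not_implyP[_ /negP]; rewrite negbK => /eqP.
Qed.

Lemma ae01E (P : R -> Prop) : ae01 P ->
  \forall t \ae @Leb R, I01 t -> P t.
Proof. by []. Qed.

Definition meas01 h : Prop := measurable_fun I01 (fun t : LebR R => h t).

Definition bounded01 h : Prop :=
  meas01 h /\ exists M : R, ae01 (fun t => `|h t| <= M).

Definition int01 h : R := \int[@Leb R]_(t in I01) h t.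

(** Completeness of the Lebesgue sigma-algebra is what allows a change on a null set. *)
Lemma meas01_ae h k : ae01 (fun t => h t = k t) -> meas01 h -> meas01 k.
Proof.
move=> hk /measurable_EFinP mh; apply/measurable_EFinP.
apply: ae_measurable_fun mh; first exact: completed_lebesgue_measure_is_complete.
by apply: filterS (ae01E hk) => t H /H /= ->.
Qed.

Lemma L1_meas h : L1 h -> meas01 h.
Proof. by move=> /measurable_int; move/measurable_EFinP. Qed.

Lemma L1_le h k : meas01 h -> L1 k -> ae01 (fun t => `|h t| <= k t) -> L1 h.
Proof.
move=> mh kL hk; apply/integrableP; split; first exact/measurable_EFinP.
have [/measurable_EFinP mk] := integrableP _ _ _ kL.
apply: le_lt_trans; apply: ae_ge0_le_integral.
- exact: measurable_I01.
- by move=> t _; exact: abse_ge0.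
- by apply/measurable_EFinP; apply: measurableT_comp.
- by move=> t _; exact: abse_ge0.
- by apply/measurable_EFinP; apply: measurableT_comp.
- apply: filterS (ae01E hk) => t H It.
  by rewrite lee_fin (le_trans (H It))// ler_norm.
Qed.

Lemma bounded01_L1 h : bounded01 h -> L1 h.
Proof.
move=> [mh [M hM]]; apply: (@L1_le h (fun=> M)) => //.
apply/integrableP; split; first exact/measurable_EFinP.
rewrite integral_cst; last exact: measurable_I01.
by rewrite [X in (_ * X)%E]leb_I01 mule1 ltry.
Qed.

Lemma L1D h k : L1 h -> L1 k -> L1 (fun t => h t + k t).
Proof.
by move=> hL kL; apply: (integrableD _ hL kL); exact: measurable_I01.
Qed.

Lemma L1Z a h : L1 h -> L1 (fun t => a * h t).
Proof.
by move=> hL; apply: (integrableZl _ a hL); exact: measurable_I01.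
Qed.

Lemma L1_abs h : L1 h -> L1 (fun t => `|h t|).
Proof.
exact: integrable_norm.
Qed.

Lemma L1M h k : L1 h -> bounded01 k -> L1 (fun t => h t * k t).
Proof.
move=> hL [mk [M kM]]; apply: (@L1_le _ (fun t => M * `|h t|)).
- by apply: measurable_funM => //; exact: L1_meas.
- by apply: L1Z; exact: L1_abs.
- by apply: ae01_imp kM => t _ kM; rewrite normrM mulrC ler_wpM2r.
Qed.

Lemma int01D h k : L1 h -> L1 k -> int01 (fun t => h t + k t) = int01 h + int01 k.
Proof.
by move=> hL kL; apply: (RintegralD _ hL kL); exact: measurable_I01.
Qed.

Lemma int01Z a h : L1 h -> int01 (fun t => a * h t) = a * int01 h.
Proof.
by move=> hL; apply: (RintegralZl a _ hL); exact: measurable_I01.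
Qed.

Lemma le_int01 h k : L1 h -> L1 k -> ae01 (fun t => h t <= k t) -> int01 h <= int01 k.
Proof.
move=> hL kL hk; rewrite -subr_ge0.
have -> : int01 k - int01 h = int01 (fun t => k t + (-1) * h t).
  by rewrite int01D ?int01Z ?mulN1r//; exact: L1Z.
have L : L1 (fun t => k t + (-1) * h t) by apply: L1D => //; exact: L1Z.
(* The difference is nonnegative only almost everywhere, whereas [Rintegral_ge0] wants it pointwise;
   the absolute value has the same integral and is nonnegative everywhere. *)
have -> : int01 (fun t => k t + (-1) * h t) = int01 (fun t => `|k t + (-1) * h t|).
  congr fine; apply: ae_eq_integral.
  - exact: measurable_I01.
  - exact: measurable_int L.
  - exact: measurable_int (L1_abs L).
  - apply: filterS (ae01E hk) => t H It; rewrite ger0_norm// mulN1r subr_ge0.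
    exact: H.
by apply: Rintegral_ge0.
Qed.

Lemma ae_eq_int01 h k : L1 h -> ae01 (fun t => h t = k t) -> int01 h = int01 k.
Proof.
move=> hL hk; congr fine; apply: ae_eq_integral.
- exact: measurable_I01.
- exact: measurable_int hL.
- by apply/measurable_EFinP; apply: meas01_ae hk _; exact: L1_meas.
- by apply: filterS (ae01E hk) => t H /H ->.
Qed.

Lemma L1_sum (I : Type) (s : seq I) (f : I -> R -> R) :
  (forall i, L1 (f i)) -> L1 (fun t => \sum_(i <- s) f i t).
Proof.
move=> Lf; elim: s => [|i s IH].
  under eq_fun do rewrite big_nil.
  by apply: bounded01_L1; split; [exact: measurable_cst | exists 0;
    apply: ae01_all => t _; rewrite normr0].
by under eq_fun do rewrite big_cons; exact: L1D.
Qed.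

Lemma int01_sum (I : Type) (s : seq I) (f : I -> R -> R) :
  (forall i, L1 (f i)) -> int01 (fun t => \sum_(i <- s) f i t) = \sum_(i <- s) int01 (f i).
Proof.
move=> Lf; elim: s => [|i s IH].
  by under eq_fun do rewrite big_nil; rewrite big_nil /int01 Rintegral_cst ?mul0r//;
    exact: measurable_I01.
under eq_fun do rewrite big_cons.
by rewrite int01D ?big_cons ?IH//; exact: L1_sum.
Qed.

Lemma L1_normE h : L1 h -> L1_norm h = (int01 (fun t => `|h t|))%:E.
Proof.
move=> hL; rewrite /int01 /Rintegral fineK//.
by apply: integrable_fin_num; [exact: measurable_I01 | exact: L1_abs].
Qed.

Lemma int01_cst a : int01 (fun=> a) = a.
Proof.
rewrite /int01 Rintegral_cst; last exact: measurable_I01.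
by rewrite [X in fine X]leb_I01 mulr1.
Qed.

Lemma int01_itv (a b : R) : 0 <= a -> a <= b -> b <= 1 ->
  int01 (fun t => ((a <= t) && (t <= b))%:R) = b - a.
Proof.
move=> a0 ab b1; rewrite /int01.
transitivity (\int[@Leb R]_(t in I01) (\1_`[a, b] t : R)).
  by apply: eq_Rintegral => t _; rewrite indicE mem_setE in_itv.
rewrite /Rintegral integral_indic//; [|exact: measurable_I01|exact: leb_measurable_itv].
rewrite setIidl; last first.
  by move=> t /=; rewrite in_itv/= => /andP[at_ tb]; apply/I01P/andP; split; lra.
rewrite [X in fine X]leb_itv lebesgue_measure_itv/= lte_fin.
by case: ltP => //= ba; apply/esym/eqP; rewrite subr_eq0 eq_le ab ba.
Qed.

(** * Essentially bounded functions and functionals on them *)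

Lemma bounded01D h k : bounded01 h -> bounded01 k ->
  bounded01 (fun t => h t + k t).
Proof.
move=> [mh [M hM]] [mk [K kK]]; split; first exact: measurable_funD.
exists (M + K); apply: ae01_imp (ae01_and hM kK) => t _ [Mt Kt].
by rewrite (le_trans (ler_normD _ _))// lerD.
Qed.

Lemma bounded01M h k : bounded01 h -> bounded01 k ->
  bounded01 (fun t => h t * k t).
Proof.
move=> [mh [M hM]] [mk [K kK]]; split; first exact: measurable_funM.
exists (M * K); apply: ae01_imp (ae01_and hM kK) => t _ [Mt Kt].
by rewrite normrM ler_pM.
Qed.

Lemma bounded01_cst a : bounded01 (fun=> a).
Proof. by split; [exact: measurable_cst | exists `|a|; exact: ae01_all]. Qed.

Lemma bounded01Z a h : bounded01 h -> bounded01 (fun t => a * h t).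
Proof. by apply: bounded01M; exact: bounded01_cst. Qed.

Lemma bounded01B h k : bounded01 h -> bounded01 k ->
  bounded01 (fun t => h t - k t).
Proof.
move=> bh bk; under eq_fun do rewrite -mulN1r.
by apply: bounded01D => //; exact: bounded01Z.
Qed.

Lemma bounded01_abs h : bounded01 h -> bounded01 (fun t => `|h t|).
Proof.
move=> [mh [M hM]]; split;
  first exact: (measurableT_comp (@normr_measurable _ setT) mh).
by exists M; apply: ae01_imp hM => t _; rewrite normr_id.
Qed.

Lemma bounded01_sum (I : Type) (s : seq I) (f : I -> R -> R) :
  (forall i, bounded01 (f i)) -> bounded01 (fun t => \sum_(i <- s) f i t).
Proof.
move=> bf; elim: s => [|i s IH].
  by under eq_fun do rewrite big_nil; exact: bounded01_cst.
by under eq_fun do rewrite big_cons; exact: bounded01D.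
Qed.

(** Covers integration against an L1 density and against a charge alike; no continuity along
    monotone limits is asked for, since a charge has none. *)
Definition linear01 (F : (R -> R) -> R) : Prop := forall a h k,
  bounded01 h -> bounded01 k -> F (fun t => a * h t + k t) = a * F h + F k.

Definition monotone01 (F : (R -> R) -> R) : Prop := forall h k,
  bounded01 h -> bounded01 k -> ae01 (fun t => h t <= k t) -> F h <= F k.

Lemma linear01_0 F : linear01 F -> F (fun=> 0) = 0.
Proof.
move=> lF; have := lF 1 _ _ (bounded01_cst 0) (bounded01_cst 0).
under eq_fun do rewrite mulr0 addr0.
by rewrite mul1r => ?; lra.
Qed.

Lemma linear01D F h k : linear01 F -> bounded01 h -> bounded01 k ->
  F (fun t => h t + k t) = F h + F k.
Proof.
move=> lF bh bk; rewrite -[F h]mul1r -lF//.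
by under [in RHS]eq_fun do rewrite mul1r.
Qed.

Lemma linear01Z F a h : linear01 F -> bounded01 h ->
  F (fun t => a * h t) = a * F h.
Proof.
move=> lF bh; have := lF a h _ bh (bounded01_cst 0).
by rewrite linear01_0// addr0; under eq_fun do rewrite addr0.
Qed.

Lemma linear01B F h k : linear01 F -> bounded01 h -> bounded01 k ->
  F (fun t => h t - k t) = F h - F k.
Proof.
move=> lF bh bk; under eq_fun do rewrite -mulN1r addrC.
by rewrite lF// mulN1r addrC.
Qed.

Lemma linear01_sum F (I : Type) (s : seq I) (f : I -> R -> R) :
  linear01 F -> (forall i, bounded01 (f i)) ->
  F (fun t => \sum_(i <- s) f i t) = \sum_(i <- s) F (f i).
Proof.
move=> lF bf; elim: s => [|i s IH].
  by under eq_fun do rewrite big_nil; rewrite big_nil linear01_0.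
under eq_fun do rewrite big_cons.
by rewrite linear01D ?big_cons ?IH//; exact: bounded01_sum.
Qed.

(** The strict inequality makes [below b - below a] the indicator of [[a, b[], so that consecutive
    cells tile without overlap, and [1 - below a] that of the closed tail from [a]. *)
Definition below (b t : R) : R := (t < b)%R%:R.

Lemma bounded01_ind A : @measurable _ (LebR R) A ->
  bounded01 (fun t => (t \in A)%:R).
Proof.
move=> mA; split.
  apply: (@eq_measurable_fun _ _ _ _ _ (\1_A : LebR R -> R)).
    by move=> t _; rewrite indicE.
  exact: measurable_indic.
by exists 1; apply: ae01_all => t _; case: (t \in A); rewrite ?normr1 ?normr0.
Qed.

Lemma bounded01_below b : bounded01 (below b).
Proof.
have := bounded01_ind (leb_measurable_itv `]-oo, b[).
by under eq_fun do rewrite mem_setE in_itv/=.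
Qed.

Lemma linear01_int01 (z : R -> R) : L1 z -> linear01 (fun h => int01 (fun t => z t * h t)).
Proof.
move=> Lz a h k bh bk; have Lh := L1M Lz bh; have Lk := L1M Lz bk.
rewrite -int01Z// -int01D//; last exact: L1Z.
by congr int01; apply/funext => t; rewrite mulrDr mulrCA.
Qed.

Lemma int01_dominated (w h : R -> R) : L1 w -> bounded01 h ->
  `|int01 (fun t => w t * h t)| <= int01 (fun t => `|w t| * `|h t|).
Proof.
move=> Lw bh; apply: le_trans (le_normr_Rintegral _ _) _.
- exact: measurable_I01.
- exact: L1M.
- rewrite le_eqVlt; apply/orP; left; apply/eqP; apply: eq_Rintegral => t _.
  by rewrite normrM.
Qed.

Lemma monotone01_int01 (w : R -> R) : L1 w ->
  monotone01 (fun h => int01 (fun t => `|w t| * h t)).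
Proof.
move=> Lw h k bh bk hk; apply: le_int01.
- by apply: L1M => //; exact: L1_abs.
- by apply: L1M => //; exact: L1_abs.
- by apply: ae01_imp hk => t _ hk; rewrite ler_wpM2l.
Qed.

(** Primitives and Stieltjes masses come on closed intervals [[0, t]]; passing to the strict
    [below t] costs only the null point [t]. *)
Lemma int01_initial (w : R -> R) (t : R) : L1 w -> 0 <= t <= 1 ->
  \int[@Leb R]_(s in `[0, t]) w s = int01 (fun s => w s * below t s).
Proof.
move=> Lw /andP[t0 t1].
rewrite Rintegral_mkcond.
transitivity (int01 (fun s => w s * (s <= t)%R%:R)).
  rewrite /int01 [RHS]Rintegral_mkcond; apply: eq_Rintegral => s _.
  rewrite !patchE !mem_setE !in_itv/=.
  case: (leP 0 s) => //= s0; case: (leP s t) => st.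
    by rewrite (le_trans st t1) mulr1.
  by rewrite mulr0 if_same.
apply: ae_eq_int01.
  apply: L1M => //.
  have := bounded01_ind (leb_measurable_itv `]-oo, t]).
  by under eq_fun do rewrite mem_setE in_itv/=.
by apply: ae01_imp (ae01_neq t) => s _ st; rewrite /below lt_neqAle st.
Qed.

(** Absolute continuity of the integral of [w] extended by zero. The extension lets [a] and [b]
    leave [0,1], as the last grid cell will do. *)
Lemma L1_abs_continuity (w : R -> R) (e : R) : L1 w -> 0 < e -> exists2 d, 0 < d &
  forall a b, a < b -> b - a < d -> int01 (fun t => `|w t| * (below b t - below a t)) <= e.
Proof.
move=> Lw e0; have Iw : (@Leb R).-integrable setT (EFin \o (w \_ I01)).
  by rewrite -restrict_EFin; exact: (iffLR (integrable_mkcond _ measurable_I01) Lw).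
have [d [d0 wd]] := integral_normr_continuous Iw e0.
exists d => // a b ltab ab.
have mab : @measurable _ (LebR R) `[a, b[ by exact: leb_measurable_itv.
have dab : (@Leb R `[a, b[ < d%:E)%E.
  by rewrite [X in (X < _)%E]leb_itv lebesgue_measure_itv/= lte_fin ltab EFinN -EFinD lte_fin.
apply: le_trans (ltW (wd _ mab dab)).
rewrite /int01 Rintegral_mkcond [leRHS]Rintegral_mkcond le_eqVlt; apply/orP; left.
apply/eqP; apply: eq_Rintegral => t _; rewrite !patchE.
case: (t \in I01); last by case: ifP => // _; rewrite /point/= normr0.
rewrite mem_setE in_itv/= /below.
have [ta|at_] := ltP t a; first by rewrite (lt_trans ta ltab) subrr mulr0.
by case: ltP => _; rewrite subr0 ?mulr1 ?mulr0.
Qed.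

Lemma cell_sum (t : nat -> R) n s : t 0 <= s -> s < t n ->
  \sum_(j < n) (below (t j.+1) s - below (t j) s) = 1.
Proof.
move=> t0 tn; rewrite -(big_mkord xpredT (fun j => below (t j.+1) s - below (t j) s)).
by rewrite telescope_sumr// /below tn ltNge t0 subr0.
Qed.

Lemma cell_ge0 (t : nat -> R) s j : {homo t : i k / (i <= k)%N >-> i <= k} ->
  0 <= below (t j.+1) s - below (t j) s.
Proof.
move=> ht; rewrite subr_ge0 /below ler_nat; case: (ltP s (t j)) => // sj.
by rewrite (lt_le_trans sj)// ht.
Qed.

Lemma cell_neq0 (t : nat -> R) s j : below (t j.+1) s - below (t j) s != 0 ->
  t j <= t j.+1 -> t j <= s < t j.+1.
Proof.
rewrite /below => nz tt; case: (ltP s (t j)) nz => [sj|js].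
  by rewrite (lt_le_trans sj tt) subrr eqxx.
by case: ltP => //; rewrite subrr eqxx.
Qed.

(** * Exchanging a primitive with a linear functional *)

Section Fubini.
Variables (w : R -> R) (F G : (R -> R) -> R) (y q : R -> R).
Hypotheses (Lw : L1 w) (lF : linear01 F) (lG : linear01 G) (mG : monotone01 G).
Hypothesis FG : forall h, bounded01 h -> `|F h| <= G (fun t => `|h t|).
Hypotheses (by_ : bounded01 y) (bq : bounded01 q).
Hypothesis yE : forall t : R, 0 <= t <= 1 -> y t = int01 (fun s => w s * below t s).
(** Says that [q t] is the [F]-mass of the tail from [t], up to the [G]-mass of any cell [[a, b[]
    around [t]. This tolerance accommodates both an exact tail and a limit of tails from the
    right. *)
Hypothesis qE : forall a t b : R, 0 <= a -> a <= t -> t < b -> t <= 1 ->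
  `|q t - F (fun s => 1 - below a s)| <= G (fun s => below b s - below a s).

(* Fubini for the functional [F], which need not come from a countably additive
   measure: on a uniform grid both sides are within [e * G 1] of
   [\sum_j (\int_cell_j w) F(1_{t_j <= s})], where [e] bounds [\int_cell |w|]. *)
Lemma exchange_integrals : int01 (fun t => w t * q t) = F y.
Proof.
have LJ := linear01_int01 Lw; have LJa := linear01_int01 (L1_abs Lw).
set F1 := fun h => int01 (fun t => w t * h t) in LJ.
set G1 := fun h => int01 (fun t => `|w t| * h t) in LJa.
have F1G1 h : bounded01 h -> `|F1 h| <= G1 (fun t => `|h t|).
  exact: int01_dominated.
have mG1 : monotone01 G1 by exact: monotone01_int01.
suff H (e : R) : 0 < e -> `|F1 q - F y| <= e * (G (fun=> 1) + G (fun=> 1)).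
  set K := G _ + G _ in H.
  have K0 : 0 <= K.
    rewrite addr_ge0// -(linear01_0 lG); apply: mG; try exact: bounded01_cst.
    - by apply: ae01_all => s _; exact: ler01.
    - by apply: ae01_all => s _; exact: ler01.
  apply/eqP; rewrite -subr_eq0 -normr_le0; apply/ler_addgt0Pr => e e0.
  rewrite add0r; apply: le_trans (H (e / (K + 1)) _) _; first by rewrite divr_gt0//;
    lra.
  rewrite mulrAC ler_pdivrMr; last lra.
  by rewrite ler_wpM2l ?(ltW e0)//; lra.
move=> e0; have [d d0 wd] := L1_abs_continuity Lw e0.
have [N Nd] : exists N : nat, N.+1%:R^-1 < d.
  by exists (Num.truncn d^-1); rewrite invf_plt ?posrE// truncnS_gt.
(* The mesh is [1 / (N + 1)], and [N + 2] cells are taken so that the right end exceeds 1 and the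
   point 1 itself lies in a half-open cell. *)
pose t j : R := j%:R / N.+1%:R; pose n := N.+2.
have wN j : int01 (fun s => `|w s| * (below (t j.+1) s - below (t j) s)) <= e.
  have tt : t j.+1 - t j = N.+1%:R^-1 by rewrite /t -mulrBl -natrB// subSn// subnn mul1r.
  by apply: wd; rewrite ?tt// -subr_gt0 tt invr_gt0.
pose c j s := below (t j.+1) s - below (t j) s.
have t0 : t 0%N = 0 by rewrite /t mul0r.
have tn : 1 < t n by rewrite /t ltr_pdivlMr// mul1r ltr_nat.
have ht : {homo t : i k / (i <= k)%N >-> i <= k}.
  by move=> i k ik; rewrite ler_wpM2r ?invr_ge0 ?ler_nat.
have c0 j s : 0 <= c j s by exact: cell_ge0.
have c1 s : 0 <= s <= 1 -> \sum_(j < n) c j s = 1.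
  by move=> /andP[s0 s1]; rewrite cell_sum ?t0// (le_lt_trans s1).
have bc j : bounded01 (c j) by apply: bounded01B; exact: bounded01_below.
pose Q j := F (fun s => 1 - below (t j) s).
have bb j : bounded01 (fun s => 1 - below (t j) s).
  by apply: bounded01B; [exact: bounded01_cst | exact: bounded01_below].
have bQc : bounded01 (fun s => \sum_(j < n) Q j * c j s).
  by apply: bounded01_sum => j; exact: bounded01Z.
have bGc : bounded01 (fun s => \sum_(j < n) G (c j) * c j s).
  by apply: bounded01_sum => j; exact: bounded01Z.
have G0 j : 0 <= G (c j).
  rewrite -(linear01_0 lG); apply: mG => //; first exact: bounded01_cst.
  by apply: ae01_all => s _; exact: c0.
(* On cell [j], [qE] replaces [q] by the constant [Q j] with error [G (c j)]. Integrating against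
   [|w|] costs a factor [e] per cell, and the [G (c j)] add up to at most [G 1]. *)
have step1 : `|F1 q - F1 (fun s => \sum_(j < n) Q j * c j s)| <= e * G (fun=> 1).
  rewrite -linear01B//; apply: le_trans (F1G1 _ _) _; first exact: bounded01B.
  apply: (@le_trans _ _ (G1 (fun s => \sum_(j < n) G (c j) * c j s))).
    apply: mG1 => //; first by apply: bounded01_abs; exact: bounded01B.
    apply: ae01_all => s s01.
    rewrite -[X in `|X - _|](mulr1) -(c1 _ s01) mulr_sumr -sumrB.
    apply: le_trans (ler_norm_sum _ _ _) _; apply: ler_sum => j _.
    rewrite -mulrBl normrM (ger0_norm (c0 _ _)).
    have [->|cj] := eqVneq (c j s) 0; first by rewrite !mulr0.
    have /andP[js sj] := cell_neq0 cj (ht _ _ (leqnSn _)).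
    case/andP: s01 => s0 s1; rewrite ler_wpM2r// qE//.
    by rewrite -t0 ht.
  rewrite (linear01_sum _ LJa); last by move=> j; exact: bounded01Z.
  rewrite (@le_trans _ _ (\sum_(j < n) G (c j) * e))//.
    apply: ler_sum => j _; rewrite (linear01Z _ LJa)// ler_wpM2l//.
    exact: wN.
  rewrite -mulr_suml mulrC -linear01_sum// ler_wpM2l ?(ltW e0)//.
  apply: mG; [exact: bounded01_sum | exact: bounded01_cst |].
  by apply: ae01_all => s /c1 ->.
(* Both sides are the finite sum of the [F1 (c j) * Q j]: for step functions the exchange is mere
   linearity. *)
have step2 : F1 (fun s => \sum_(j < n) Q j * c j s) =
    F (fun s => \sum_(j < n) F1 (c j) * (1 - below (t j) s)).
  rewrite (linear01_sum _ LJ); last by move=> j; exact: bounded01Z.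
  rewrite (linear01_sum _ lF); last by move=> j; exact: bounded01Z.
  by apply: eq_bigr => j _; rewrite (linear01Z _ LJ)// (linear01Z _ lF)// mulrC.
have bS : bounded01 (fun s => \sum_(j < n) F1 (c j) * (1 - below (t j) s)).
  by apply: bounded01_sum => j; exact: bounded01Z.
(* For fixed [s], the sum is the integral of [w] over the cells starting at or before [s], while
   [y s] is its integral up to [s]. The two differ only inside the cell of [s], hence by at most
   [e]. *)
have step3 : `|F (fun s => \sum_(j < n) F1 (c j) * (1 - below (t j) s)) - F y|
    <= e * G (fun=> 1).
  rewrite -linear01B//; apply: le_trans (FG _) _; first exact: bounded01B.
  rewrite -linear01Z//; last exact: bounded01_cst.
  apply: mG.
  - by apply: bounded01_abs; exact: bounded01B.
  - by apply: bounded01Z; exact: bounded01_cst.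
  apply: ae01_all => s s01; rewrite mulr1 yE//.
  rewrite -/(F1 (below s)).
  have -> : \sum_(j < n) F1 (c j) * (1 - below (t j) s) =
      F1 (fun r => \sum_(j < n) (1 - below (t j) s) * c j r).
    rewrite (linear01_sum _ LJ); last by move=> j; exact: bounded01Z.
    by apply: eq_bigr => j _; rewrite (linear01Z _ LJ)// mulrC.
  have bc' : bounded01 (fun r => \sum_(j < n) (1 - below (t j) s) * c j r).
    by apply: bounded01_sum => j; exact: bounded01Z.
  rewrite -linear01B//; last exact: bounded01_below.
  apply: le_trans (F1G1 _ _) _; first by apply: bounded01B => //;
    exact: bounded01_below.
  apply: (@le_trans _ _ (G1 (fun r => \sum_(j < n) c j s * c j r))).
    apply: mG1.
    - by apply: bounded01_abs; apply: bounded01B => //; exact: bounded01_below.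
    - by apply: bounded01_sum => j; exact: bounded01Z.
    apply: ae01_all => r r01.
    have -> : below s r = \sum_(j < n) c j r * below s r.
      by rewrite -mulr_suml c1// mul1r.
    rewrite -sumrB.
    apply: le_trans (ler_norm_sum _ _ _) _; apply: ler_sum => j _.
    rewrite [c j r * _]mulrC -mulrBl normrM (ger0_norm (c0 _ _)).
    have [->|cj] := eqVneq (c j r) 0; first by rewrite !mulr0.
    have /andP[jr rj] := cell_neq0 cj (ht _ _ (leqnSn _)).
    (* With [r] in cell [j], the two indicators agree when [s] lies before or after that cell, and
       differ by at most 1 when [s] lies in it. *)
    rewrite ler_wpM2r// /c /below.
    have [sj|js] := ltP s (t j).
      rewrite (lt_le_trans sj (ht _ _ (leqnSn _))) ltNge (le_trans (ltW sj) jr).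
      by rewrite !subrr normr0.
    have [sj|js'] := ltP s (t j.+1).
      by rewrite subr0; case: (r < s);
        rewrite ?subr0 ?subrr ?sub0r ?normrN ?normr1 ?normr0.
    by rewrite (lt_le_trans rj js') subr0 subrr normr0 subrr.
  rewrite (linear01_sum _ LJa); last by move=> j; exact: bounded01Z.
  rewrite (@le_trans _ _ (\sum_(j < n) c j s * e))//.
    apply: ler_sum => j _; rewrite (linear01Z _ LJa)// ler_wpM2l//.
    exact: wN.
  by rewrite -mulr_suml c1// mul1r.
rewrite mulrDr; apply: le_trans (lerD step1 step3); rewrite step2.
set X := F (fun s => \sum_(j < n) _);
  have -> : F1 q - F y = (F1 q - X) + (X - F y) by lra.
exact: ler_normD.
Qed.

End Fubini.

(** * Integration against a charge *)

(** Rounding down serves twice: a bounded function gets a finite range, which makes it simple, and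
    an arbitrary one a countable range, which reduces measurability to level sets. *)
Definition grid (e x : R) : R := e * (Num.floor (x / e))%:~R.

Lemma grid_dist (e x : R) : 0 < e -> `|grid e x - x| <= e.
Proof.
move=> e0; have /andP[l u] := floor_itv (x / e).
rewrite /grid; set f := _%:~R in l *; rewrite intrD -/f in u.
have xe : x = e * (x / e) by rewrite mulrCA divff ?mulr1// gt_eqF.
rewrite [X in _ - X]xe -mulrBr normrM gtr0_norm// -[leRHS]mulr1 ler_pM2l// ler_norml;
  apply/andP; split; lra.
Qed.

Lemma grid_measurable (e : R) : 0 < e -> measurable_fun setT (grid e).
Proof.
move=> e0; apply: nondecreasing_measurable => // x y xy.
by rewrite /grid ler_pM2l// ler_int le_floor// ler_pM2r ?invr_gt0.
Qed.

(** Extend by zero outside [0,1], truncate at the essential bound and round to the grid of mesh [e];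
    truncation alters [h] on a null set only. *)
Lemma simple_approximation (h : R -> R) (e : R) : bounded01 h -> 0 < e ->
  exists s : {sfun (LebR R) >-> R}, ae01 (fun t => `|s t - h t| <= e).
Proof.
move=> [mh [M hM]] e0; pose M' := `|M|.
pose h1 (t : LebR R) := grid e (Num.max (- M') (Num.min M' (((fun t : LebR R => h t) \_ I01) t))).
have mh1 : measurable_fun setT h1.
  apply: (measurableT_comp (grid_measurable e0)).
  apply: measurable_maxr; first exact: measurable_cst.
  apply: measurable_minr; first exact: measurable_cst.
  exact: (measurable_restrictT _ measurable_I01).1.
have fh1 : finite_set (range h1).
  (* Truncation confines the floors to integers of modulus at most [K]; the two images below are the
     nonnegative and the negative ones. *)
  pose K := (Num.truncn (M' / e)).+1.
  have MK : M' / e < K%:R by exact: truncnS_gt.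
  apply: (@sub_finite_set _ _ (((fun n : nat => e * n%:R) @` `I_K.+1) `|`
      ((fun n : nat => - (e * n%:R)) @` `I_K.+1))).
    move=> _ [t _ <-]; rewrite /h1 /grid; set x := Num.max _ _.
    have M0 : 0 <= M' by exact: normr_ge0.
    have xM : - M' <= x <= M'.
      by rewrite /x le_max lexx/= ge_max ge_min lexx/= andbT; lra.
    have /andP[fl fu] := floor_itv (x / e).
    have x1 : x / e < K%:R.
      by apply: le_lt_trans MK; rewrite ler_pM2r ?invr_gt0//; case/andP: xM.
    have x2 : - K%:R < x / e.
      rewrite ltrNl -mulNr; apply: le_lt_trans MK; rewrite ler_pM2r ?invr_gt0//.
      by rewrite lerNl; case/andP: xM.
    case: (Num.floor _) fl fu => m fl fu; [left|right].
      exists m => //=; rewrite ltnS -(ler_nat R) ltW//.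
      exact: le_lt_trans fl x1.
    exists m.+1; last by rewrite NegzE mulrNz mulrN.
    rewrite /= ltnS -(ltr_nat R).
    move: fu; rewrite NegzE intrD mulrNz -natr1 => fu.
    have : - K%:R < - (m%:R : R).
      apply: lt_trans x2 _; apply: lt_le_trans fu _.
      by rewrite -pmulrn -natr1; lra.
    by rewrite ltrN2 /K -natr1.
  by rewrite finite_setU; split; apply: finite_image; exact: finite_II.
have sh1 : h1 \in sfun by rewrite inE; apply/andP; split; rewrite inE.
exists (sfun_Sub sh1); apply: ae01_imp hM => t t01 ht.
rewrite /= /h1 patchE mem_set; last exact/I01P.
suff -> : Num.max (- M') (Num.min M' (h t)) = h t by exact: grid_dist.
have := le_trans ht (ler_norm M); rewrite ler_norml => /andP[h1' h2].
by rewrite min_r// max_r.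
Qed.

Section ChargeIntegral.
Variable zeta : {additive_charge set (LebR R) -> \bar R}.
Hypotheses (baz : ba zeta) (pz : positive_charge zeta).

Local Notation z A := (fine (zeta A)).
Local Notation SI s := (fine (sintegral zeta s)).

Lemma charge_fineK (A : set (LebR R)) : measurable A -> (z A)%:E = zeta A.
Proof. by move=> mA; rewrite fineK//; exact: fin_num_measure. Qed.

Lemma fine_charge0 : z set0 = 0.
Proof.
have /[!big_ord0] -> // := @charge_semi_additive _ _ _ zeta (fun=> set0) 0%N.
exact: trivIset_set0.
Qed.

Lemma fine_chargeU (A B : set (LebR R)) : measurable A -> measurable B ->
  A `&` B = set0 -> z (A `|` B) = z A + z B.
Proof.
move=> mA mB AB0.
have z0 : zeta set0 = 0%E by rewrite -charge_fineK ?fine_charge0.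
rewrite (semi_additiveW z0 charge_semi_additive)//; last exact: measurableU.
by rewrite fineD//; exact: fin_num_measure.
Qed.

Lemma fine_charge_ge0 (A : set (LebR R)) : measurable A -> 0 <= z A.
Proof. by move=> mA; apply: fine_ge0; exact: pz. Qed.

Lemma fine_charge_null (A : set (LebR R)) : measurable A ->
  @Leb R (A `&` I01) = 0%E -> z A = 0.
Proof. by move=> mA A0; rewrite (baz.2 _ mA A0). Qed.

Lemma fine_charge_setT : z setT = z I01.
Proof.
have mI := measurable_I01.
rewrite -(setUv I01) fine_chargeU//; [|exact: measurableC|exact: setICr].
by rewrite (@fine_charge_null (~` _)) ?addr0//;
  [exact: measurableC|rewrite setICl measure0].
Qed.

Lemma fine_charge_partition (I : eqType) (S : seq I) (f : LebR R -> I)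
    (A : set (LebR R)) : uniq S -> (forall t, f t \in S) ->
  (forall i, measurable (f @^-1` [set i])) -> measurable A ->
  z A = \sum_(i <- S) z (A `&` f @^-1` [set i]).
Proof.
move=> uS fS mf mA.
rewrite -[in LHS](setIT A) (_ : setT = f @^-1` [set i | i \in S]); last first.
  by apply/seteqP; split => t //= _; exact: fS.
elim: S uS {fS} => [_|i S IH /= /andP[iS uS]].
  by rewrite big_nil (_ : _ @^-1` _ = set0) ?setI0 ?fine_charge0// -subset0.
have mS : measurable (f @^-1` [set j | j \in S]).
  rewrite (_ : _ @^-1` _ = \bigcup_(j in [set` S]) f @^-1` [set j]); last first.
    by apply/seteqP; split => [t /= ft|t [j /= jS ->]//]; exists (f t).
  by apply: fin_bigcup_measurable => //.
rewrite big_cons -IH// -fine_chargeU; first last.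
- apply/seteqP; split => // t [[_ /= fi] [_ /=]]; rewrite fi.
  by rewrite (negbTE iS).
- exact: measurableI.
- exact: measurableI.
congr (fine (zeta _)); rewrite -setIUr; congr (_ `&` _).
apply/seteqP; split => t /=.
  by rewrite inE => /orP[/eqP ->|]; [left|right].
by rewrite inE => -[->|->]; rewrite ?eqxx ?orbT.
Qed.

(** [sintegral] sums over the values of [s], and level sets change from one simple function to
    another. Evaluation on any finite partition on which [s] is constant lets two simple functions
    share cells, so that finite additivity suffices for linearity and monotonicity. *)
Lemma sintegral_partition (I : eqType) (S : seq I) (f : LebR R -> I)
    (c : I -> R) (s : {sfun (LebR R) >-> R}) : uniq S -> (forall t, f t \in S) ->
  (forall i, measurable (f @^-1` [set i])) -> (forall t, s t = c (f t)) ->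
  sintegral zeta s = (\sum_(i <- S) c i * z (f @^-1` [set i]))%:E.
Proof.
move=> uS fS mf sE.
have ms x : measurable (s @^-1` [set x] : set (LebR R)).
  by rewrite -[X in measurable X]setTI; exact: measurable_funPT.
pose X := undup (map c S).
have sX t : s t \in X by rewrite mem_undup sE; apply/mapP; exists (f t).
transitivity (\sum_(x <- X) x * z (s @^-1` [set x]))%:E.
  rewrite /sintegral -sumEFin -(fsbig_widen [set` X] setT)//=; last first.
    move=> x [_ /= xX]; rewrite (_ : _ @^-1` _ = set0) ?charge_fineK//.
      by rewrite -charge_fineK// fine_charge0 mule0.
    by rewrite -subset0 => t /= stx; apply: xX; rewrite -stx; exact: sX.
  rewrite -fsbig_seq ?undup_uniq//.
  by apply: eq_bigr => x _; rewrite EFinM charge_fineK.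
congr EFin.
(* Both families are refined to the intersections of a level set of [s] with a cell of [f]; such an
   intersection is empty unless [x = c i]. *)
under eq_bigr => x _ do rewrite (fine_charge_partition uS fS mf (ms x)) mulr_sumr.
rewrite exchange_big/=; apply: eq_bigr => i _.
rewrite (fine_charge_partition (undup_uniq _) sX ms (mf i)) mulr_sumr.
apply: eq_bigr => x _; have [->|xi] := eqVneq x (c i).
  by rewrite setIC.
rewrite (_ : _ `&` _ = set0) 1?(_ : (f @^-1` _) `&` _ = set0) ?fine_charge0 ?mulr0//.
  rewrite -subset0 => t [/= ft sx]; move: xi; rewrite -sx sE ft eqxx//.
by rewrite -subset0 => t [/= sx ft]; move: xi; rewrite -sx sE ft eqxx.
Qed.

Lemma sfun_range (s : {sfun (LebR R) >-> R}) :
  exists2 X : seq R, uniq X & forall t, s t \in X.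
Proof.
have /finite_seqP[X rX] : finite_set (range s) by exact: fimfunP.
exists (undup X); first exact: undup_uniq.
move=> t; rewrite mem_undup; have : range s (s t) by exists t.
by rewrite rX.
Qed.

Lemma sfun_joint_partition (s t : {sfun (LebR R) >-> R}) :
  exists S : seq (R * R), [/\ uniq S, forall r, (s r, t r) \in S &
    forall i, measurable ((fun r => (s r, t r)) @^-1` [set i] : set (LebR R))].
Proof.
have [X uX sX] := sfun_range s; have [Y uY tY] := sfun_range t.
exists [seq (x, y) | x <- X, y <- Y]; split.
- by apply: allpairs_uniq => // -[x y] [x' y'].
- by move=> r; apply/allpairsP; exists (s r, t r); split => /=;
  [exact: sX|exact: tY|by []].
- move=> [x y]; rewrite (_ : _ @^-1` _ = s @^-1` [set x] `&` t @^-1` [set y]).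
    apply: measurableI.
    + by rewrite -[X in measurable X]setTI; exact: measurable_funPT.
    + by rewrite -[X in measurable X]setTI; exact: measurable_funPT.
  by apply/seteqP; split => r /= => [[-> ->]|[-> ->]].
Qed.

Lemma sintegral_linear (a : R) (s t u : {sfun (LebR R) >-> R}) :
  (forall r, u r = a * s r + t r) -> SI u = a * SI s + SI t.
Proof.
move=> uE; have [S [uS inS mS]] := sfun_joint_partition s t.
rewrite (@sintegral_partition _ _ _ (fun p => a * p.1 + p.2) u uS inS mS)//.
rewrite (@sintegral_partition _ _ _ fst s uS inS mS)//.
rewrite (@sintegral_partition _ _ _ snd t uS inS mS)//=.
by rewrite mulr_sumr -big_split/=; apply: eq_bigr => i _; rewrite mulrDl mulrA.
Qed.

(** On a joint cell either the values compare or the cell meets [0,1] in a null set, which carries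
    no charge. The slack [c] absorbs uniform approximation errors. *)
Lemma sintegral_le (c : R) (s t : {sfun (LebR R) >-> R}) :
  ae01 (fun r => s r <= t r + c) -> SI s <= SI t + c * z I01.
Proof.
move=> st; have [S [uS inS mS]] := sfun_joint_partition s t.
rewrite (@sintegral_partition _ _ _ fst s uS inS mS)//.
rewrite (@sintegral_partition _ _ _ snd t uS inS mS)//=.
rewrite -fine_charge_setT (fine_charge_partition uS inS mS)// mulr_sumr -big_split/=.
apply: ler_sum => -[x y] _ /=; rewrite setTI -mulrDl.
have [xy|xy] := leP x (y + c); first by rewrite ler_wpM2r// fine_charge_ge0.
rewrite fine_charge_null ?mulr0//.
have [N [mN N0 sN]] := ae01E st.
apply/eqP; rewrite -measure_le0 -[leRHS]N0 le_measure ?inE//.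
  by apply: measurableI => //; exact: measurable_I01.
move=> r [/= [sx ty] Ir]; apply: sN => /= /(_ Ir).
by rewrite sx ty leNgt xy.
Qed.

Lemma sintegral_indic_charge (A : set (LebR R)) (s : {sfun (LebR R) >-> R}) :
  measurable A -> (forall r, s r = (r \in A)%:R) -> SI s = z A.
Proof.
move=> mA sA.
have mI b : measurable ((fun r => r \in A) @^-1` [set b] : set (LebR R)).
  case: b; first by rewrite (_ : _ @^-1` _ = A)//; apply/seteqP; split => r /=;
    [move/set_mem|move/mem_set].
  rewrite (_ : _ @^-1` _ = ~` A); first exact: measurableC.
  by apply/seteqP; split => r /=; [move/negbT; rewrite notin_setE|move=> ?;
    apply/negbTE; rewrite notin_setE].
rewrite (@sintegral_partition _ [:: true;
  false] (fun r => r \in A) (fun b => b%:R) s)//.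
  rewrite !big_cons big_nil /= mul1r mul0r !addr0; congr (fine (zeta _)).
  by apply/seteqP; split => r /=; [move/set_mem|move/mem_set].
by move=> r; case: (r \in A).
Qed.

Lemma Linfty_le (f : R -> R) (e : R) : 0 <= e ->
  (Lnorm (@Leb R) +oo ((fun t : LebR R => (f t)%:E) \_ I01) <= e%:E)%E <->
  ae01 (fun t => `|f t| <= e).
Proof.
move=> e0; rewrite unlock leb_setT_gt0; split => [/ess_supP|fe].
  rewrite /ae01; apply: filterS => t /=; rewrite patchE => + It.
  by rewrite mem_set.
apply/ess_supP; apply: filterS (ae01E fe) => t ft /=; rewrite patchE.
by case: ifPn => [/set_mem/ft|_]; rewrite ?lee_fin//= normr0.
Qed.

(** An epsilon form of [is_charge_integral]: one simple function per tolerance is easier to combine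
    than sequences. *)
Definition simple_approx (h : R -> R) (r : R) : Prop := forall e : R, 0 < e ->
  exists s : {sfun (LebR R) >-> R}, ae01 (fun t => `|s t - h t| <= e) /\
    `|SI s - r| <= e.

Lemma sintegral_fin_num (s : {sfun (LebR R) >-> R}) :
  sintegral zeta s \is a fin_num.
Proof.
have [S [uS inS mS]] := sfun_joint_partition s s.
by rewrite (@sintegral_partition _ _ _ fst s uS inS mS).
Qed.

Lemma charge_integral_approx (E : set (LebR R)) (k : R -> R) (r : R) :
  is_charge_integral zeta E k r <-> simple_approx (k \_ E) r.
Proof.
split=> [[s s0 sr] e e0|sk].
  move/fine_cvgP: s0 => [s0fin s0]; move/fine_cvgP: sr => [srfin sr].
  have [j [j1 [j2 j3]]] : exists j, [/\ Lnorm (@Leb R) +oo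
      ((fun t : LebR R => (s j t - (k \_ E) t)%:E) \_ I01) \is a fin_num,
      `|0 - fine (Lnorm (@Leb R) +oo
      ((fun t : LebR R => (s j t - (k \_ E) t)%:E) \_ I01))| < e &
      `|r - SI (s j)| < e].
    move/cvgrPdist_lt: s0 => /(_ _ e0) s0; move/cvgrPdist_lt: sr => /(_ _ e0) sr.
    have [j _ Hj] := filterI s0fin (filterI s0 sr).
    by have [a [b c]] := Hj j (leqnn j); exists j; split.
  exists (s j); split; last by rewrite distrC ltW.
  apply/Linfty_le; first exact: ltW.
  rewrite -(fineK j1) lee_fin; apply: ltW; move: j2.
  by rewrite sub0r normrN; apply: le_lt_trans; exact: ler_norm.
have pos j : 0 < j.+1%:R^-1 :> R by rewrite invr_gt0.
have [s sP] := choice (fun j => sk _ (pos j)).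
have c0 : (fun j : nat => (j.+1%:R^-1 : R)%:E) @ \oo --> 0%E.
  by apply/fine_cvgP; split; [exact: nearW | exact: cvg_harmonic].
exists s.
  apply: (@squeeze_cvge _ _ _ _ (fun=> 0%E) _ (fun j : nat => (j.+1%:R^-1 : R)%:E)) => //.
    apply: nearW => j; rewrite Lnorm_ge0/=; apply/Linfty_le; first exact/ltW.
    by have [] := sP j.
  exact: cvg_cst.
apply/fine_cvgP; split; first by apply: nearW => j; exact: sintegral_fin_num.
apply/cvgrPdist_le => e e0.
have /fine_cvgP[_ /cvgrPdist_le/(_ _ e0)] := c0.
apply: filterS => j /=; rewrite sub0r normrN ger0_norm ?(ltW (pos j))// => je.
by rewrite distrC (le_trans _ je)//; have [] := sP j.
Qed.

Lemma simple_approx_le (h k : R -> R) (r r' : R) :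
  simple_approx h r -> simple_approx k r' -> ae01 (fun t => h t <= k t) ->
  r <= r'.
Proof.
move=> hr kr hk.
have z0 : 0 <= z I01 by apply: fine_charge_ge0; exact: measurable_I01.
apply/ler_addgt0Pr => e e0.
(* Each of the two integrals is off by [d], and the pointwise error [2 * d] is weighted by the total
   charge: [2 * d + 2 * d * z I01 = e]. *)
have d0 : 0 < e / (2 + 2 * z I01) by rewrite divr_gt0//; lra.
set d := _ / _ in d0.
have dE : d * (2 + 2 * z I01) = e by rewrite /d mulfVK//; lra.
have [s [sh sr]] := hr _ d0; have [t [tk tr]] := kr _ d0.
have st : SI s <= SI t + (2 * d) * z I01.
  apply: sintegral_le; apply: ae01_imp (ae01_and hk (ae01_and sh tk)) => u _.
  rewrite !ler_norml => -[hku [/andP[s1 s2] /andP[t1 t2]]].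
  have : s u <= t u + d + d by apply: le_trans (_ : h u + d <= _); lra.
  lra.
move: sr tr; rewrite !ler_norml => /andP[s1 s2] /andP[t1 t2].
have : r <= r' + d + d + 2 * d * z I01 by lra.
lra.
Qed.

Lemma simple_approx_linear (a : R) (h k : R -> R) (r r' : R) :
  simple_approx h r -> simple_approx k r' ->
  simple_approx (fun t => a * h t + k t) (a * r + r').
Proof.
move=> hr kr e e0.
have d0 : 0 < e / (`|a| + 1) by rewrite divr_gt0//; have := normr_ge0 a; lra.
set d := _ / _ in d0.
have dE : d * (`|a| + 1) = e by rewrite /d mulfVK// gt_eqF//; have := normr_ge0 a; lra.
have [s [sh sr]] := hr _ d0; have [t [tk tr]] := kr _ d0.
pose u : {sfun (LebR R) >-> R} := cst_sfun a * s + t.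
have uE x : u x = a * s x + t x by [].
exists u; split.
  apply: ae01_imp (ae01_and sh tk) => x _ [shx tkx].
  rewrite uE (_ : _ - _ = a * (s x - h x) + (t x - k x)); last by lra.
  apply: le_trans (ler_normD _ _) _; rewrite normrM -dE mulrDr mulr1 lerD//.
  by rewrite mulrC ler_wpM2r.
rewrite (sintegral_linear uE) (_ : _ - _ = a * (SI s - r) + (SI t - r')); last by lra.
apply: le_trans (ler_normD _ _) _; rewrite normrM -dE mulrDr mulr1 lerD//.
by rewrite mulrC ler_wpM2r.
Qed.

(* The integral is the supremum of the integrals of the simple functions below
   [h]; a uniform approximation of [h] within [e] pins it down up to
   [e * zeta I01]. *)
Lemma simple_approx_exists (h : R -> R) : bounded01 h ->
  exists r, simple_approx h r.
Proof.
move=> bh.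
have z0 : 0 <= z I01 by apply: fine_charge_ge0; exact: measurable_I01.
pose S := [set x | exists2 s : {sfun (LebR R) >-> R},
  ae01 (fun t => s t <= h t) & x = SI s].
have approx (e : R) : 0 < e -> exists2 s : {sfun (LebR R) >-> R},
    ae01 (fun t => `|s t - h t| <= e) &
    S (SI s - e * z I01) /\ ubound S (SI s + e * z I01).
  move=> e0; have [s sh] := simple_approximation bh e0; exists s => //; split.
    pose o : {sfun (LebR R) >-> R} := 1.
    (* Lowering [s] by its error [e] puts it below [h], so that its integral competes in the
       supremum. *)
    pose u : {sfun (LebR R) >-> R} := cst_sfun (- e) * o + s.
    exists u.
      apply: ae01_imp sh => t _; rewrite ler_norml => /andP[s1 s2].
      by change (- e * 1 + s t <= h t); lra.
    have uE x : u x = - e * o x + s x by [].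
    rewrite (sintegral_linear uE) (@sintegral_indic_charge setT o)//.
      by rewrite fine_charge_setT mulNr addrC.
    by move=> r; rewrite in_setT.
  move=> _ [t th ->]; apply: sintegral_le.
  apply: ae01_imp (ae01_and th sh) => x _; rewrite ler_norml => -[t1 /andP[s1 s2]].
  lra.
have [s1 _ [S1 ub1]] := approx 1 ltr01.
have hS : has_sup S by split; [exists (SI s1 - 1 * z I01) | exists (SI s1 + 1 * z I01)].
exists (sup S) => e e0.
have d0 : 0 < e / (z I01 + 1) by rewrite divr_gt0//; lra.
set d := _ / _ in d0.
have dE : d * (z I01 + 1) = e by rewrite /d mulfVK//; lra.
have [s sh [Ss ubs]] := approx _ d0.
have dz : 0 <= d * z I01 by rewrite mulr_ge0// ltW.
exists s; split.
  by apply: ae01_imp sh => t _ /le_trans; apply; lra.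
have l1 := sup_upper_bound hS Ss.
have l2 : sup S <= SI s + d * z I01 by apply: ge_sup => //; case: hS.
by rewrite ler_norml; apply/andP; split; lra.
Qed.

(** Integrating over the whole line is harmless, because a charge in [ba] ignores everything outside
    [0,1]. A domain [E] is moved into the integrand by [charge_integralE], which leaves a functional
    of functions alone. *)
Definition zint (h : R -> R) : R := charge_integral zeta setT h.

Lemma simple_approx_uniq (h : R -> R) (r r' : R) :
  simple_approx h r -> simple_approx h r' -> r = r'.
Proof.
move=> hr hr'; apply/eqP; rewrite eq_le; apply/andP; split.
  by apply: (simple_approx_le hr hr'); exact: ae01_all.
by apply: (simple_approx_le hr' hr); exact: ae01_all.
Qed.

Lemma zintP (h : R -> R) : bounded01 h -> simple_approx h (zint h).
Proof.
move=> /simple_approx_exists[r hr]; rewrite /zint /charge_integral.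
have hT : h = h \_ setT by rewrite patch_setT.
by rewrite {1}hT; apply/charge_integral_approx; apply: getPex; exists r;
  apply/charge_integral_approx; rewrite -hT.
Qed.

Lemma zint_linear : linear01 zint.
Proof.
move=> a h k bh bk; apply: (@simple_approx_uniq (fun t => a * h t + k t)).
  by apply: zintP; apply: bounded01D => //; exact: bounded01Z.
by apply: simple_approx_linear; exact: zintP.
Qed.

Lemma zint_monotone : monotone01 zint.
Proof. by move=> h k bh bk; apply: simple_approx_le; exact: zintP. Qed.

Lemma charge_integralE (E : set (LebR R)) (k : R -> R) :
  charge_integral zeta E k = zint (fun t => k t * (t \in E)%:R).
Proof.
rewrite /zint /charge_integral; congr get; apply/funext => r; apply/propext.
rewrite !charge_integral_approx patch_setT (_ : k \_ E = (fun t => k t * (t \in E)%:R))//.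
by apply/funext => t; rewrite patchE; case: ifP; rewrite ?mulr1 ?mulr0.
Qed.

Lemma zint_indic (A : set (LebR R)) : measurable A ->
  zint (fun t => (t \in A)%:R) = z A.
Proof.
move=> mA; pose s : {sfun (LebR R) >-> R} := indic_sfun _ mA.
have sE t : s t = (t \in A)%:R by rewrite -indicE.
apply: (@simple_approx_uniq (fun t => (t \in A)%:R)).
  by apply: zintP; exact: bounded01_ind.
move=> e e0; exists s; split.
  by apply: ae01_all => t _; rewrite sE subrr normr0 ltW.
by rewrite (sintegral_indic_charge mA sE) subrr normr0 ltW.
Qed.

End ChargeIntegral.

End Lebesgue01.

(** * Data along an admissible process *)

Section Data.
Context {R : realType} {n m : nat}.

Lemma cvg_mx p q (f : nat -> 'M[R]_(p, q)) (M : 'M[R]_(p, q)) :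
  (forall i j, f k i j @[k --> \oo] --> M i j) -> f @ \oo --> M.
Proof.
move=> H U [P nP PU].
have : \forall k \near \oo, forall i j, P i j (f k i j).
  by apply: filter_forall => i; apply: filter_forall => j; exact: H.
by apply: filterS => k Pk; exact: PU.
Qed.

Lemma jointly_continuous_cvg (k : R -> 'cV[R]_n -> 'cV[R]_m -> R)
    (s : nat -> R) (a : nat -> 'cV[R]_n) (b : nat -> 'cV[R]_m) (t : R) (a0 : 'cV[R]_n) (b0 : 'cV[R]_m) :
  jointly_continuous k -> (forall j, 0 <= s j <= 1) -> 0 <= t <= 1 ->
  s @ \oo --> t -> a @ \oo --> a0 -> b @ \oo --> b0 ->
  k (s j) (a j) (b j) @[j --> \oo] --> k t a0 b0.
Proof.
move=> /subspace_continuousP kc s01 t01 st aa bb.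
pose f j := (s j, a j, b j).
have fc : f @ \oo --> (t, a0, b0) by exact: (cvg_pair (cvg_pair st aa) bb).
apply: cvg_trans (kc (t, a0, b0) t01) => /= U /= HU.
have : \forall j \near \oo, 0 <= (f j).1.1 <= 1 -> U (k (f j).1.1 (f j).1.2 (f j).2).
  exact: (fc _ HU).
by apply: filterS => j; apply; exact: s01.
Qed.

Lemma meas01_countable (I : countType) (f : R -> I) (g : I -> R) :
  (forall i, @measurable _ (LebR R) (I01 `&` f @^-1` [set i])) ->
  meas01 (fun t => g (f t)).
Proof.
move=> mf _ Y mY.
rewrite (_ : _ `&` _ = \bigcup_i (if g i \in Y then I01 `&` f @^-1` [set i] else set0)).
  apply: countable_bigcupT_measurable => // i; case: ifP => // _; exact: mf.
apply/seteqP; split => [t [It Yt]|t [i _]].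
  by exists (f t) => //; rewrite mem_set.
case: ifPn => // /set_mem gY [It fi]; split => //.
by rewrite /= (_ : f t = i).
Qed.

Lemma L1_primitive_cvg (w : R -> R) (s : nat -> R) (t : R) : L1 w ->
  s @ \oo --> t ->
  int01 (fun r => w r * below (s j) r) @[j --> \oo] --> int01 (fun r => w r * below t r).
Proof.
move=> Lw st; apply/cvgrPdist_le => e e0.
have [d d0 wd] := L1_abs_continuity Lw e0.
have H a b : a < b -> b - a < d ->
    `|int01 (fun r => w r * below b r) - int01 (fun r => w r * below a r)| <= e.
  move=> ab bad; have LJ := linear01_int01 Lw.
  rewrite -(linear01B LJ); [|exact: bounded01_below|exact: bounded01_below].
  apply: le_trans (int01_dominated Lw _) _.
    by apply: bounded01B; exact: bounded01_below.
  apply: le_trans (wd _ _ ab bad); rewrite le_eqVlt; apply/orP; left; apply/eqP.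
  congr int01; apply/funext => r; congr (_ * _);
    rewrite ger0_norm// subr_ge0 /below ler_nat.
  by case: (ltP r a) => // ra; rewrite (lt_trans ra ab).
move/cvgrPdist_lt: st => /(_ _ d0); apply: filterS => j sj.
have [jt|tj|->] := ltgtP (s j) t.
- by apply: H => //; apply: le_lt_trans sj; exact: ler_norm.
- by rewrite distrC; apply: H => //; apply: le_lt_trans sj; rewrite distrC ler_norm.
- by rewrite subrr normr0 ltW.
Qed.

Lemma L1_primitive_bound (w : R -> R) (t : R) : L1 w ->
  `|int01 (fun r => w r * below t r)| <= int01 (fun r => `|w r|).
Proof.
move=> Lw; apply: le_trans (int01_dominated Lw (bounded01_below t)) _.
apply: le_int01; [|exact: L1_abs|].
- apply: L1M; first exact: L1_abs.
  by apply: bounded01_abs; exact: bounded01_below.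
- apply: ae01_all => s _; rewrite ler_piMr// /below.
  by case: (s < t); rewrite ?normr1 ?normr0.
Qed.

(** The sequences stay in [0,1] because the values of a trajectory elsewhere are arbitrary; sampling
    at grid points needs no more. *)
Definition seq_continuous01 (f : R -> R) : Prop :=
  forall (s : nat -> R) (t : R), (forall j, 0 <= s j <= 1) -> 0 <= t <= 1 ->
  s @ \oo --> t -> f (s j) @[j --> \oo] --> f t.

Lemma has_L1_derivativeE p (x w : R -> 'cV[R]_p) (i : 'I_p) (t : R) :
  has_L1_derivative x w -> 0 <= t <= 1 ->
  x t i 0 = x 0 i 0 + int01 (fun s => w s i 0 * below t s).
Proof. by move=> [Lw xE] t01; rewrite xE// (int01_initial (Lw i)). Qed.

Lemma has_L1_derivative_continuous p (x w : R -> 'cV[R]_p) (i : 'I_p) :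
  has_L1_derivative x w -> seq_continuous01 (fun t => x t i 0).
Proof.
move=> xw s t s01 t01 st; rewrite (has_L1_derivativeE i xw t01).
under eq_fun do rewrite (has_L1_derivativeE i xw (s01 _)).
by apply: cvgD; [exact: cvg_cst | apply: L1_primitive_cvg => //; case: xw].
Qed.

Lemma has_L1_derivative_bounded p (x w : R -> 'cV[R]_p) :
  has_L1_derivative x w ->
  exists C : R, forall t i, 0 <= t <= 1 -> `|x t i 0| <= C.
Proof.
move=> xw; exists (\sum_i (`|x 0 i 0| + int01 (fun r => `|w r i 0|))) => t i t01.
rewrite (has_L1_derivativeE i xw t01) (bigD1 i)//=.
have J0 j : 0 <= `|x 0 j 0| + int01 (fun r => `|w r j 0|).
  by rewrite addr_ge0//; apply: Rintegral_ge0.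
apply: le_trans (ler_normD _ _) _; rewrite -[leLHS]addr0 lerD ?sumr_ge0//.
by rewrite lerD2l L1_primitive_bound//; case: xw.
Qed.

Lemma grid_cvg (x : R) : grid j.+1%:R^-1 x @[j --> \oo] --> x.
Proof.
apply/cvgrPdist_le => e e0; have /cvgrPdist_le/(_ _ e0) := @cvg_harmonic R.
apply: filterS => j /=; rewrite sub0r normrN ger0_norm ?invr_ge0// => je.
by rewrite distrC (le_trans _ je)// grid_dist// invr_gt0.
Qed.

Lemma grid01 (j : nat) (t : R) : 0 <= t <= 1 -> 0 <= grid j.+1%:R^-1 t <= 1.
Proof.
move=> /andP[t0 t1].
have j0 : 0 < j.+1%:R^-1 :> R by rewrite invr_gt0.
have /andP[fl _] := floor_itv (t / j.+1%:R^-1).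
rewrite /grid mulr_ge0 ?(ltW j0)//=; last first.
  by rewrite ler0z floor_ge0 divr_ge0// ltW.
by apply: le_trans t1; rewrite mulrC -ler_pdivlMr.
Qed.

Lemma meas01_floor (f : R -> R) (e : R) (z : int) : 0 < e -> meas01 f ->
  @measurable _ (LebR R) (I01 `&` [set t | Num.floor (f t / e) = z]).
Proof.
move=> e0 mf.
rewrite (_ : _ `&` _ = I01 `&` f @^-1` (grid e @^-1` [set e * z%:~R])); last first.
  congr (_ `&` _); apply/seteqP; split => t /=; first by rewrite /grid => ->.
  by rewrite /grid => /(mulfI (lt0r_neq0 e0))/intr_inj.
apply: mf; first exact: measurable_I01.
rewrite -[X in measurable X]setTI; apply: grid_measurable => //.
Qed.

(* [along k x u] is the limit of its values at the grid points below [t] and the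
   coordinates of [u t]; these take countably many values. *)
Lemma along_meas01 (k : R -> 'cV[R]_n -> 'cV[R]_m -> R)
    (x : R -> 'cV[R]_n) (u : R -> 'cV[R]_m) :
  jointly_continuous k -> (forall i, seq_continuous01 (fun t => x t i 0)) ->
  (forall i, meas01 (fun t => u t i 0)) -> meas01 (along k x u).
Proof.
move=> kc xc mu.
pose e j : R := j.+1%:R^-1.
have e0 j : 0 < e j by rewrite invr_gt0.
pose h j t := k (grid (e j) t) (x (grid (e j) t)) (\col_i grid (e j) (u t i 0)).
apply: (@measurable_fun_cvg _ _ _ _ (fun j (t : LebR R) => h j t)) => [j|t /I01P t01].
  pose f t : int * {ffun 'I_m -> int} :=
    (Num.floor (t / e j), [ffun i => Num.floor (u t i 0 / e j)]).
  pose g (p : int * {ffun 'I_m -> int}) := let t := e j * p.1%:~R in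
    k t (x t) (\col_i (e j * (p.2 i)%:~R)).
  have -> : (fun t : LebR R => h j t) = (fun t : LebR R => g (f t)).
    apply/funext => t; rewrite /h /g /f/=; congr (k _ _ _).
    by apply/colP => i; rewrite !mxE ffunE.
  apply: meas01_countable => -[z c].
  rewrite (_ : _ `&` _ = (I01 `&` [set t | Num.floor (t / e j) = z]) `&`
      \bigcap_(i in [set: 'I_m]) (I01 `&` [set t | Num.floor (u t i 0 / e j) = c i])).
    apply: measurableI; first apply: meas01_floor => //.
    apply: leb_measurable_fun; [exact: measurable_itv | exact: measurable_id].
    apply: fin_bigcap_measurable => // i _; exact: meas01_floor.
  apply/seteqP; split => [t [It [fz fc]]|t [[It fz] H]].
    split; first by split.
    by move=> i _; split => //=; rewrite -fc ffunE.
  split => //=; congr (_, _) => //; apply/ffunP => i; rewrite ffunE.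
  by have [] := H i I.
apply: jointly_continuous_cvg => //.
- by move=> j; exact: grid01.
- exact: grid_cvg.
- apply: cvg_mx => i j; rewrite (ord1 j); apply: xc => //; last exact: grid_cvg.
  by move=> r; exact: grid01.
- apply: cvg_mx => i j; rewrite (ord1 j); under eq_fun do rewrite mxE.
  exact: grid_cvg.
Qed.

Lemma box_compact p (C : R) :
  compact [set v : 'cV[R]_p | forall i, `|v i 0| <= C].
Proof.
have rc : compact [set r : 'rV[R]_p | forall i, `[- C, C]%classic (r ord0 i)].
  by apply: (@rV_compact _ _ (fun=> `[(- C), C]%classic)) => _; exact: segment_compact.
have tc : continuous (@trmx R 1 p).
  move=> r U [Q nQ QU]; exists (fun i j => Q j i) => [i j|v Qv].
    by have := nQ j i; rewrite mxE.
  by apply: QU => i j; rewrite mxE; exact: Qv.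
rewrite (_ : [set v | _] = @trmx R 1 p @` [set r : 'rV[R]_p |
    forall i, `[- C, C]%classic (r ord0 i)]).
  by apply: continuous_compact => //; exact: continuous_subspaceT.
apply/seteqP; split => [v vC|_ [r rC <-] i].
  exists v^T; last by rewrite trmxK.
  by move=> i; rewrite /= in_itv/= mxE -ler_norml; exact: vC.
by have := rC i; rewrite /= in_itv/= -ler_norml mxE.
Qed.

Lemma jointly_continuous_bounded (k : R -> 'cV[R]_n -> 'cV[R]_m -> R) (C : R) :
  jointly_continuous k -> exists B : R, forall (t : R) (a : 'cV[R]_n) (b : 'cV[R]_m), 0 <= t <= 1 ->
  (forall i, `|a i 0| <= C) -> (forall i, `|b i 0| <= C) ->
  `|k t a b| <= B.
Proof.
move=> kc; pose K : set (R * 'cV[R]_n * 'cV[R]_m) := (`[0, 1]%classic `*`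
  [set v : 'cV[R]_n | forall i, `|v i 0| <= C]) `*`
  [set v : 'cV[R]_m | forall i, `|v i 0| <= C].
have Kc : compact K.
  apply: compact_setX; last exact: box_compact.
  by apply: compact_setX; [exact: segment_compact | exact: box_compact].
have kK : {within K, continuous (fun p => k p.1.1 p.1.2 p.2)}.
  apply: continuous_subspaceW kc => -[[t a] b] [[/= t01 _] _].
  by move: t01; rewrite in_itv.
have [B [_ HB]] := compact_bounded (continuous_compact kK Kc).
exists (B + 1) => t a b t01 aC bC; apply: (HB (B + 1)); first by rewrite ltrDl.
by exists (t, a, b) => //; split => //; split => //; rewrite /= in_itv.
Qed.

Lemma along_bounded01 (k : R -> 'cV[R]_n -> 'cV[R]_m -> R)
    (x : R -> 'cV[R]_n) (u : R -> 'cV[R]_m) (C : R) :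
  jointly_continuous k -> (forall i, seq_continuous01 (fun t => x t i 0)) ->
  (forall t i, 0 <= t <= 1 -> `|x t i 0| <= C) ->
  (forall i, meas01 (fun t => u t i 0)) ->
  ae01 (fun t => forall i, `|u t i 0| <= C) -> bounded01 (along k x u).
Proof.
move=> kc xc xC mu uC; split; first exact: along_meas01.
have [B HB] := jointly_continuous_bounded C kc.
by exists B; apply: ae01_imp uC => t t01 ut; apply: HB => // i; exact: xC.
Qed.

Lemma enorm_ge_coord p (v : 'cV[R]_p) i : `|v i 0| <= enorm v.
Proof.
rewrite /enorm -sqrtr_sqr ler_sqrt; last by apply: sumr_ge0 => j _; exact: sqr_ge0.
by rewrite (bigD1 i)//= lerDl; apply: sumr_ge0 => j _; exact: sqr_ge0.
Qed.

Lemma enorm_le_sum p (v : 'cV[R]_p) : enorm v <= \sum_i `|v i 0|.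
Proof.
have s0 : 0 <= \sum_i `|v i 0| by apply: sumr_ge0.
rewrite -[leRHS]ger0_norm// -sqrtr_sqr /enorm ler_sqrt ?sqr_ge0//.
rewrite expr2 mulr_suml; apply: ler_sum => i _.
rewrite -real_normK ?num_real// expr2 ler_wpM2l// (bigD1 i)//= lerDl.
by apply: sumr_ge0.
Qed.

Lemma Linfty_bounded p (u : R -> 'cV[R]_p) : Linfty u ->
  (forall i, meas01 (fun t => u t i 0)) /\
  exists C : R, ae01 (fun t => forall i, `|u t i 0| <= C).
Proof.
move=> [mu uoo]; split => //.
have u0 : (0 <= Linfty_norm u)%E by exact: Lnorm_ge0.
have ufin : Linfty_norm u \is a fin_num by rewrite ge0_fin_numE.
exists (fine (Linfty_norm u)).
have /Linfty_le : (Linfty_norm u <= (fine (Linfty_norm u))%:E)%E by rewrite fineK.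
move=> /(_ (fine_ge0 u0)); apply: ae01_imp => t _.
by move=> /(le_trans (ler_norm _)) ut i; exact: le_trans (enorm_ge_coord _ _) ut.
Qed.

(** Samples of [f] at grid points to the right of [t] are measurable and converge to [f t] on the
    open interval; the two endpoints form a null set. *)
Lemma right_continuous_meas01 (f : R -> R) :
  (forall t : R, 0 < t < 1 -> f s @[s --> t^'+] --> f t) -> meas01 f.
Proof.
move=> fr.
pose e j : R := j.+1%:R^-1.
have e0 j : 0 < e j by rewrite invr_gt0.
(* Adding one mesh to the rounded value gives a point strictly greater than [t], as the limit from
   the right requires. *)
pose up j t := grid (e j) t + e j.
have mh j : meas01 (fun t => f (up j t)).
  apply: (@meas01_countable _ (fun t => Num.floor (t / e j)) (fun z => f (e j * z%:~R + e j))).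
  move=> z; apply: meas01_floor => //.
  by apply: leb_measurable_fun; [exact: measurable_itv | exact: measurable_id].
have mo : measurable_fun (`]0, 1[ : set (LebR R)) (fun t : LebR R => f t).
  apply: (@measurable_fun_cvg _ _ _ _ (fun j (t : LebR R) => f (up j t))) => [j|t].
    apply: measurable_funS (mh j); first exact: measurable_I01.
    by apply: subset_itv; rewrite bnd_simp.
  rewrite /= in_itv/= => t01; apply: (cvg_comp _ _ _ (fr t t01)).
  have upt : up j t @[j --> \oo] --> t.
    rewrite -[X in _ --> X]addr0; apply: cvgD; first exact: grid_cvg.
    exact: cvg_harmonic.
  move=> U /= HU; suff : \forall j \near \oo, U (up j t) by [].
  have : \forall j \near \oo, t < up j t -> U (up j t) := upt _ HU.
  apply: filterS => j; apply; rewrite /up /grid.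
  have /andP[_] := floor_itv (t / e j).
  by rewrite ltr_pdivrMr// intrD mulrDl mul1r mulrC.
apply: (@meas01_ae R (((fun t : LebR R => f t) \_ `]0, 1[) : R -> R)).
  apply: ae01_imp (ae01_and (ae01_neq 0) (ae01_neq 1)) => t /andP[t0 t1] [t0' t1'].
  by rewrite patchE mem_set//= in_itv/= !lt_neqAle t0 t1 eq_sym t0' t1'.
apply: measurable_funTS.
exact: (measurable_restrictT _ (leb_measurable_itv `]0, 1[)).1 mo.
Qed.

Lemma seq_continuous_meas01 (f : R -> R) : seq_continuous01 f -> meas01 f.
Proof.
move=> fc; pose e j : R := j.+1%:R^-1.
have e0 j : 0 < e j by rewrite invr_gt0.
apply: (@measurable_fun_cvg _ _ _ _ (fun j (t : LebR R) => f (grid (e j) t))).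
  move=> j; apply: (@meas01_countable _ (fun t => Num.floor (t / e j))
    (fun z => f (e j * z%:~R))) => z; apply: meas01_floor => //.
  by apply: leb_measurable_fun; [exact: measurable_itv | exact: measurable_id].
move=> t /I01P t01; apply: fc => //; last exact: grid_cvg.
by move=> j; exact: grid01.
Qed.

Lemma has_L1_derivative_bounded01 p (x w : R -> 'cV[R]_p) i :
  has_L1_derivative x w -> bounded01 (fun t => x t i 0).
Proof.
move=> xw; split.
  by apply: seq_continuous_meas01; exact: has_L1_derivative_continuous xw.
have [C xC] := has_L1_derivative_bounded xw.
by exists C; apply: ae01_all => t; exact: xC.
Qed.

Lemma jointly_continuous_coord p q (k : R -> 'cV[R]_n -> 'cV[R]_m -> 'M[R]_(p, q))
    i j : jointly_continuous k -> jointly_continuous (fun t a b => k t a b i j).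
Proof.
move=> /subspace_continuousP kc; apply/subspace_continuousP => r r01.
exact: (cvg_comp _ _ (kc r r01) (@coord_continuous _ _ _ i j _)).
Qed.

End Data.

(** * Charges with a bounded density *)

Section ChargeWeight.
Context {R : realType}.
Variable zeta : {additive_charge set (LebR R) -> \bar R}.
Hypotheses (baz : ba zeta) (pz : positive_charge zeta).
Local Notation zint := (zint zeta).
Let zl := zint_linear baz pz.
Let zm := zint_monotone baz pz.

Lemma zint_ae (h k : R -> R) : bounded01 h -> bounded01 k ->
  ae01 (fun t => h t = k t) -> zint h = zint k.
Proof.
move=> bh bk hk; apply/eqP; rewrite eq_le; apply/andP; split; apply: zm => //.
  by apply: ae01_imp hk => t _ ->.
by apply: ae01_imp hk => t _ ->.
Qed.

Lemma zint_abs (h : R -> R) : bounded01 h -> `|zint h| <= zint (fun t => `|h t|).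
Proof.
move=> bh; have bn := bounded01_abs bh.
rewrite ler_norml; apply/andP; split.
  rewrite -[leLHS]mulN1r -(linear01Z _ zl bn); apply: zm => //.
    exact: bounded01Z.
  by apply: ae01_all => t _; rewrite mulN1r lerNl -normrN ler_norm.
by apply: zm => //; apply: ae01_all => t _; exact: ler_norm.
Qed.

Variables (g : R -> R) (K : R).
Hypotheses (bg : bounded01 g) (K0 : 0 <= K) (gK : ae01 (fun t => `|g t| <= K)).

Lemma zint_weight_linear : linear01 (fun h => zint (fun t => g t * h t)).
Proof.
move=> a h k bh bk; have bgh := bounded01M bg bh; have bgk := bounded01M bg bk.
rewrite -zl//; congr (zint _); apply/funext => t; lra.
Qed.

Lemma zint_scale_linear : linear01 (fun h => K * zint h).
Proof. by move=> a h k bh bk; rewrite zl//; lra. Qed.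

Lemma zint_scale_monotone : monotone01 (fun h => K * zint h).
Proof. by move=> h k bh bk hk; rewrite ler_wpM2l// zm. Qed.

Lemma zint_weight_dominated (h : R -> R) : bounded01 h ->
  `|zint (fun t => g t * h t)| <= K * zint (fun t => `|h t|).
Proof.
move=> bh; have bn := bounded01_abs bh; have bgh := bounded01M bg bh.
apply: le_trans (zint_abs bgh) _; rewrite -(linear01Z _ zl bn).
apply: zm; [exact: bounded01_abs | exact: bounded01Z |].
by apply: ae01_imp gK => t _ gt; rewrite normrM ler_wpM2r.
Qed.

(** The assumption speaks of sets, hence by linearity of simple functions; [f] is a uniform limit of
    these, and an error [e] changes the integral by at most [e * K * zeta I01]. *)
Lemma zint_weight_eq0 (f : R -> R) : bounded01 f ->
  (forall E : set (LebR R), measurable E -> E `<=` I01 ->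
    charge_integral zeta E g = 0) ->
  zint (fun t => g t * f t) = 0.
Proof.
move=> bf gE0; pose C := K * fine (zeta I01).
have C0 : 0 <= C.
  by rewrite mulr_ge0//; apply: fine_charge_ge0 => //; exact: measurable_I01.
suff H (e : R) : 0 < e -> `|zint (fun t => g t * f t)| <= e * C.
  apply/eqP; rewrite -normr_le0; apply/ler_addgt0Pr => e e0; rewrite add0r.
  apply: le_trans (H (e / (C + 1)) _) _; first by rewrite divr_gt0//; lra.
  rewrite mulrAC ler_pdivrMr; last lra.
  by rewrite ler_wpM2l ?(ltW e0)//; lra.
move=> e0; have [s sf] := simple_approximation bf e0.
have [X uX sX] := sfun_range s.
have mS x : measurable (s @^-1` [set x] : set (LebR R)).
  by rewrite -[X in measurable X]setTI; exact: measurable_funPT.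
have bind x := bounded01_ind (mS x).
have sE t : s t = \sum_(x <- X) x * (t \in s @^-1` [set x])%:R.
  rewrite (bigD1_seq (s t))//= big1_seq ?addr0.
    by rewrite mem_set// mulr1.
  by move=> x /andP[xs _]; rewrite memNset ?mulr0// => /= sx; rewrite sx eqxx in xs.
have bs : bounded01 s.
  rewrite (_ : (s : R -> R) = fun t => \sum_(x <- X) x * (t \in s @^-1` [set x])%:R).
    by apply: bounded01_sum => x; exact: bounded01Z.
  by apply/funext => t; exact: sE.
have s0 : zint (fun t => g t * s t) = 0.
  rewrite (_ : (fun t => g t * s t) =
    fun t => \sum_(x <- X) x * (g t * (t \in s @^-1` [set x])%:R)); last first.
    apply/funext => t; rewrite sE mulr_sumr; apply: eq_bigr => x _; lra.
  rewrite (linear01_sum _ zl); last first.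
    by move=> x; apply: bounded01Z; exact: bounded01M.
  apply: big1 => x _; rewrite (linear01Z _ zl); last exact: bounded01M.
  (* Level sets extend beyond [0,1], where the assumption says nothing; intersecting with [I01] does
     not change the charge integral. *)
  have mE : measurable ((s @^-1` [set x] : set (LebR R)) `&` I01).
    by apply: measurableI => //; exact: measurable_I01.
  rewrite -[RHS](mulr0 x) -(gE0 _ mE); last by move=> t [].
  rewrite charge_integralE; congr (_ * _); apply: zint_ae.
  - exact: bounded01M.
  - by apply: bounded01M => //; exact: bounded01_ind.
  - apply: ae01_all => t t01; have It : t \in I01 by apply: mem_set; exact/I01P.
    by rewrite in_setI It andbT.
rewrite -[zint _]subr0 -s0 -(linear01B zl); [|exact: bounded01M|exact: bounded01M].
rewrite (_ : (fun t => _) = fun t => g t * (f t - s t)); last first.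
  by apply/funext => t; rewrite mulrBr.
apply: le_trans (zint_weight_dominated _) _; first exact: bounded01B.
rewrite /C mulrCA ler_wpM2l//.
rewrite -(fine_charge_setT baz) -(zint_indic baz pz); last exact: measurableT.
rewrite -(linear01Z _ zl); last by apply: bounded01_ind; exact: measurableT.
apply: zm.
- by apply: bounded01_abs; exact: bounded01B.
- by apply: bounded01Z; apply: bounded01_ind; exact: measurableT.
- by apply: ae01_imp sf => t _; rewrite in_setT mulr1 distrC.
Qed.

(* [beta] is a limit from the right on (0,1) but is given without a limit at 0;
   freezing 0 makes all points of [0,1] obey the same formula. *)
Definition shift (k : nat) (t : R) : R := if t == 0 then 0 else t + k.+1%:R^-1.

Lemma shift_ge k t : t <= shift k t.
Proof. by rewrite /shift; case: eqP => [->//|_]; rewrite lerDl. Qed.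

Lemma shift_homo k a b : 0 <= a -> a <= b -> shift k a <= shift k b.
Proof.
move=> a0 ab; rewrite {1}/shift; case: eqP => [_|/eqP an].
  exact: le_trans (le_trans a0 ab) (shift_ge _ _).
rewrite /shift gt_eqF ?lerD2r//; apply: lt_le_trans ab.
by rewrite lt_neqAle eq_sym an.
Qed.

Lemma shift_lt t b : t < b -> \forall k \near \oo, shift k t < b.
Proof.
move=> tb; have bt : 0 < b - t by rewrite subr_gt0.
have /cvgrPdist_lt/(_ _ bt) := @cvg_harmonic R.
apply: filterS => k /=; rewrite sub0r normrN ger0_norm ?invr_ge0// => kb.
by rewrite /shift; case: eqP => [t0|_]; [rewrite -t0 | rewrite addrC -ltrBrDr].
Qed.

Variable q : R -> R.
Hypothesis qlim : forall t, 0 <= t <= 1 ->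
  zint (fun s => g s * (1 - below (shift k t) s)) @[k --> \oo] --> q t.

Lemma tail_difference (a b : R) : a <= b ->
  `|zint (fun s => g s * (1 - below b s)) - zint (fun s => g s * (1 - below a s))|
    <= K * zint (fun s => below b s - below a s).
Proof.
move=> ab; have b1 (c : R) : bounded01 (fun s => 1 - below c s).
  by apply: bounded01B; [exact: bounded01_cst | exact: bounded01_below].
rewrite -(linear01B zint_weight_linear)//.
apply: le_trans (zint_weight_dominated _) _; first exact: bounded01B.
rewrite le_eqVlt; apply/orP; left; apply/eqP; congr (_ * zint _).
apply/funext => s; rewrite (_ : _ - (1 - _) = - (below b s - below a s)); last by lra.
rewrite normrN ger0_norm//.
by rewrite subr_ge0 /below ler_nat; case: (ltP s a) => // sa;
  rewrite (lt_le_trans sa ab).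
Qed.

Lemma below_step (a b c : R) : b <= c ->
  zint (fun s => below b s - below a s) <= zint (fun s => below c s - below a s).
Proof.
move=> bc; apply: zm.
- by apply: bounded01B; exact: bounded01_below.
- by apply: bounded01B; exact: bounded01_below.
- apply: ae01_all => s _; rewrite lerD2r /below ler_nat.
  by case: (ltP s b) => // sb; rewrite (lt_le_trans sb bc).
Qed.

(** Supplies [qE] for the charge: as [t < b] is strict, [shift k t] eventually lies in [[a, b[], and
    the bound between two tails survives the limit. *)
Lemma tail_limit (a t b : R) : 0 <= a -> a <= t -> t < b -> t <= 1 ->
  `|q t - zint (fun s => g s * (1 - below a s))|
    <= K * zint (fun s => below b s - below a s).
Proof.
move=> a0 at_ tb t1; have t01 : 0 <= t <= 1 by rewrite (le_trans a0).
set c := zint (fun s => g s * (1 - below a s)).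
have H : zint (fun s => g s * (1 - below (shift k t) s)) - c @[k --> \oo] --> q t - c.
  by apply: cvgB; [exact: qlim | exact: cvg_cst].
apply: (ler_cvg_to (cvg_norm H) (cvg_cst _)).
apply: filterS (shift_lt tb) => k kb.
apply: le_trans (tail_difference _) _; first exact: le_trans at_ (shift_ge _ _).
by rewrite ler_wpM2l// below_step// ltW.
Qed.

(** Telescoping: [H] plays the distribution function that dominates the increments. *)
Lemma sum_zip_le (f : R * R -> R) (H : R -> R) (a : R) (s : seq R) : 0 <= a ->
  (forall b c, 0 <= b -> b <= c -> f (b, c) <= H c - H b) ->
  path <%R a s -> \sum_(p <- zip (a :: s) s) f p <= H (last a s) - H a.
Proof.
move=> a0 fH; elim: s a a0 => [|b s IH] a a0 /=; first by rewrite big_nil subrr.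
move=> /andP[ab sb]; rewrite big_cons.
have b0 : 0 <= b by rewrite (le_trans a0)// ltW.
have := IH b b0 sb; have := fH a b a0 (ltW ab); lra.
Qed.

Lemma path_le_last (a : R) (s : seq R) : path <%R a s -> a <= last a s.
Proof.
elim: s a => [|b s IH] a //= /andP[ab sb].
exact: le_trans (ltW ab) (IH _ sb).
Qed.

Lemma zip_path (a : R) (s : seq R) (p : R * R) : path <%R a s ->
  p \in zip (a :: s) s -> a <= p.1 <= last a s /\ a <= p.2 <= last a s.
Proof.
elim: s a => [|b s IH] a //= /andP[ab sb]; have bl := path_le_last sb.
rewrite inE => /orP[/eqP -> /=|/(IH _ sb)[/andP[p1 ->] /andP[p2 ->]]].
  by rewrite lexx bl (ltW ab) (le_trans (ltW ab) bl).
by rewrite (le_trans (ltW ab) p1) (le_trans (ltW ab) p2).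
Qed.

Lemma zint_belowB (a b : R) : K * zint (below b) - K * zint (below a) =
  K * zint (fun s => below b s - below a s).
Proof. by rewrite -mulrBr -(linear01B zl)//; exact: bounded01_below. Qed.

(** For each [k] the shifted tails have increments dominated by those of a nondecreasing function of
    total increase at most [K * zint 1]; the sum over a fixed finite partition passes to the limit
    in [k]. *)
Lemma tail_variation (s : seq R) : itv_partition 0 1 s ->
  \sum_(p <- zip (0 :: s) s) `|q p.2 - q p.1| <= K * zint (fun=> 1).
Proof.
move=> [ps /eqP ls].
pose T k t := zint (fun r => g r * (1 - below (shift k t) r)).
have Tq : \sum_(p <- zip (0 :: s) s) `|T k p.2 - T k p.1| @[k --> \oo] -->
    \sum_(p <- zip (0 :: s) s) `|q p.2 - q p.1|.
  have : forall p, p \in zip (0 :: s) s -> (0 <= p.1 <= 1) /\ (0 <= p.2 <= 1).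
    by move=> p /(zip_path ps); rewrite ls.
  elim: (zip _ _) => [_|p r IH H].
    by rewrite big_nil; under eq_fun do rewrite big_nil; exact: cvg_cst.
  rewrite big_cons; under eq_fun do rewrite big_cons.
  have [p1 p2] := H _ (mem_head _ _).
  apply: cvgD.
    have D : T k p.2 - T k p.1 @[k --> \oo] --> q p.2 - q p.1.
      by apply: cvgB; exact: qlim.
    exact: cvg_norm D.
  by apply: IH => p' p'r; apply: H; rewrite inE p'r orbT.
apply: (ler_cvg_to Tq (cvg_cst _)); apply: nearW => k.
apply: le_trans (@sum_zip_le _ (fun t => K * zint (below (shift k t))) 0 s _ _ ps) _ => //.
  move=> b c b0 bc /=; rewrite zint_belowB.
  by apply: tail_difference; exact: shift_homo.
rewrite ls zint_belowB.
rewrite ler_wpM2l//; apply: zm.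
- by apply: bounded01B; exact: bounded01_below.
- exact: bounded01_cst.
- apply: ae01_all => t _; rewrite /below.
  by case: (t < shift k 1); case: (t < shift k 0);
    rewrite ?subrr ?subr0 ?sub0r// -subr_ge0 opprK addr_ge0.
Qed.

End ChargeWeight.

(** * Bounded variation and Gronwall estimates *)

Section BoundedVariation.
Context {R : realType} {n : nat}.
Implicit Types F : R -> 'cV[R]_n.

Lemma coord_le_sum (v : 'I_n -> R) i : (forall j, 0 <= v j) -> v i <= \sum_j v j.
Proof. by move=> v0; rewrite (bigD1 i)//= lerDl; exact: sumr_ge0. Qed.

Lemma enorm_ge0 p (v : 'cV[R]_p) : 0 <= enorm v.
Proof. exact: sqrtr_ge0. Qed.

Lemma vvariation_ge (F : R -> 'cV[R]_n) (s : seq R) : (vvariation F < +oo)%E ->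
  itv_partition 0 1 s ->
  \sum_(p <- zip (0 :: s) s) enorm (F p.2 - F p.1) <= fine (vvariation F).
Proof.
move=> Foo ps; rewrite -lee_fin fineK.
  by apply: ereal_sup_ubound; exists s.
rewrite fin_numElt Foo andbT; apply: (@lt_le_trans _ _ 0%E) => //.
apply: (@le_trans _ _ (\sum_(p <- zip (0 :: s) s) enorm (F p.2 - F p.1))%:E).
  by rewrite lee_fin sumr_ge0// => p _; exact: enorm_ge0.
by apply: ereal_sup_ubound; exists s.
Qed.

Lemma BV_increment F (t : R) (i : 'I_n) : (vvariation F < +oo)%E ->
  0 <= t <= 1 -> `|F t i 0 - F 0 i 0| <= fine (vvariation F).
Proof.
move=> Foo /andP[t0 t1].
have c (a b : R) : `|F b i 0 - F a i 0| <= enorm (F b - F a).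
  by have := enorm_ge_coord (F b - F a) i; rewrite !mxE.
have p1 : itv_partition (0 : R) 1 [:: 1] by split; rewrite /= ?ltr01.
(* Partitions are strictly increasing, so [t] can be inserted only if it is interior; the endpoints
   use the trivial partition. *)
have [->|tn0] := eqVneq t 0.
  rewrite subrr normr0; apply: le_trans (vvariation_ge Foo p1).
  by apply: sumr_ge0 => p _; exact: enorm_ge0.
have [->|tn1] := eqVneq t 1.
  apply: le_trans (vvariation_ge Foo p1).
  by rewrite /= big_seq1; exact: c.
have t0' : 0 < t by rewrite lt_neqAle eq_sym tn0.
have t1' : t < 1 by rewrite lt_neqAle tn1.
have pt : itv_partition 0 1 [:: t; 1] by split; rewrite /= ?t0' ?t1'.
apply: le_trans (vvariation_ge Foo pt).
by rewrite /= big_cons big_seq1 (le_trans (c _ _))//= lerDl enorm_ge0.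
Qed.

Lemma BV_bounded F : BV F ->
  exists C : R, forall (t : R) i, 0 <= t <= 1 -> `|F t i 0| <= C.
Proof.
move=> [Foo _]; exists (\sum_i `|F 0 i 0| + fine (vvariation F)) => t i t01.
rewrite -[F t i 0](subrK (F 0 i 0)) addrC.
apply: le_trans (ler_normD _ _) _; rewrite lerD//; last exact: BV_increment.
exact: (@coord_le_sum (fun j => `|F 0 j 0|)).
Qed.

Lemma BV_bounded01 F i : BV F -> bounded01 (fun t => F t i 0).
Proof.
move=> bF; split; last first.
  by have [C FC] := BV_bounded bF; exists C; apply: ae01_all => t; exact: FC.
apply: right_continuous_meas01 => t t01.
exact: (cvg_comp _ _ (bF.2 t t01) (@coord_continuous _ _ _ i 0 (F t))).
Qed.

Lemma vvariation_le F (V : 'I_n -> R) :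
  (forall s, itv_partition 0 1 s -> forall i,
    \sum_(p <- zip (0 :: s) s) `|F p.2 i 0 - F p.1 i 0| <= V i) ->
  (vvariation F <= (\sum_i V i)%:E)%E.
Proof.
move=> FV; apply: ge_ereal_sup => _ [s ps <-]; rewrite lee_fin.
apply: (@le_trans _ _ (\sum_(p <- zip (0 :: s) s) \sum_i `|F p.2 i 0 - F p.1 i 0|)).
  apply: ler_sum => p _; apply: le_trans (enorm_le_sum _) _.
  by apply: ler_sum => i _; rewrite !mxE.
by rewrite exchange_big/=; apply: ler_sum => i _; exact: FV.
Qed.

End BoundedVariation.

Section Gronwall.
Context {R : realType}.

(** Backward form with [D] chosen before [L]. The interval is exhausted from 1 downwards in slabs so
    short that the contribution of the new slab is at most half of the supremum of [L]; the assumed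
    bound on [L], which does not enter [D], makes that supremum finite. *)
Lemma gronwall (C K : R) : 0 <= C -> 0 <= K -> exists D : R,
  forall L : R -> R, bounded01 L -> (forall t, 0 <= L t) ->
  (exists B : R, forall t : R, 0 <= t <= 1 -> L t <= B) ->
  (forall t : R, 0 <= t <= 1 -> L t <= K + C * int01 (fun s => L s * (1 - below t s))) ->
  forall t : R, 0 <= t <= 1 -> L t <= D.
Proof.
(* A slab of length [1 / N] with [N > 2 * C] contributes at most the factor [C / N <= 1 / 2]. *)
move=> C0 K0; pose N := (Num.truncn (2 * C)).+1.
have NC : 2 * C < N%:R by exact: truncnS_gt.
have N0 : 0 < N%:R :> R by rewrite ltr0n.
have H (k : nat) : exists2 D : R, 0 <= D &
    forall L : R -> R, bounded01 L -> (forall t, 0 <= L t) ->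
    (exists B : R, forall t : R, 0 <= t <= 1 -> L t <= B) ->
    (forall t : R, 0 <= t <= 1 -> L t <= K + C * int01 (fun s => L s * (1 - below t s))) ->
    forall t : R, 0 <= t <= 1 -> 1 - k%:R / N%:R < t -> L t <= D.
  elim: k => [|k [D D0 IH]].
    (* No [t <= 1] satisfies [1 < t], so any constant starts the induction. *)
    by exists 0 => // L _ _ _ _ t /andP[_ t1]; rewrite mul0r subr0 ltNge t1.
  (* The next constant solves [S = K + C * D + S / 2]. *)
  have CD : 0 <= C * D by rewrite mulr_ge0.
  exists (2 * (K + C * D)) => [|L bL L0 [B LB] LK r r01 rk]; first lra.
  pose a := Num.max 0 (1 - k.+1%:R / N%:R : R).
  pose b := Num.max a (1 - k%:R / N%:R).
  have kN : k.+1%:R / N%:R = k%:R / N%:R + N%:R^-1 :> R.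
    by rewrite -natr1 mulrDl mul1r.
  have k0 : 0 <= k%:R / N%:R :> R by rewrite divr_ge0.
  have Ni : 0 < N%:R^-1 :> R by rewrite invr_gt0.
  have a0 : 0 <= a by rewrite le_max lexx.
  have a1 : a <= 1 by rewrite ge_max ler01/=; lra.
  have ab : a <= b by rewrite le_max lexx.
  have b1 : b <= 1 by rewrite ge_max a1/=; lra.
  have bma : b - a <= N%:R^-1.
    rewrite lerBlDr ge_max; apply/andP; split; first by rewrite lerDr ltW.
    have : 1 - k.+1%:R / N%:R <= a by rewrite le_max lexx orbT.
    by rewrite kN; lra.
  pose S := sup [set L t | t in [set t : R | 0 <= t <= 1 /\ 1 - k.+1%:R / N%:R < t]].
  have hS : has_sup [set L t | t in [set t : R | 0 <= t <= 1 /\ 1 - k.+1%:R / N%:R < t]].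
    split; first by exists (L r), r.
    by exists B => _ [t [t01 _] <-]; exact: LB.
  have LS t : 0 <= t <= 1 -> 1 - k.+1%:R / N%:R < t -> L t <= S.
    by move=> t01 tk; apply: sup_upper_bound => //; exists t.
  have S0 : 0 <= S by apply: le_trans (L0 r) (LS _ r01 rk).
  have Lr t : 0 <= t <= 1 -> 1 - k.+1%:R / N%:R < t -> L t <= K + C * D + S / 2.
    move=> t01 tk; apply: le_trans (LK t t01) _; rewrite -addrA lerD2l.
    have bI : bounded01 (fun s => ((a <= s) && (s <= b))%:R).
      have := bounded01_ind (leb_measurable_itv `[a, b]).
      by under eq_fun do rewrite mem_setE in_itv/=.
    have LI := bounded01_L1 bI.
    (* Above [1 - k / N] the induction hypothesis gives [D]; the remaining part of the tail lies in
       the new slab [[a, b]], where [L] is at most [S]. *)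
    have J1 : int01 (fun s => L s * (1 - below t s)) <=
        int01 (fun s => D * 1 + S * ((a <= s) && (s <= b))%:R).
      apply: le_int01.
      - apply: bounded01_L1; apply: bounded01M => //.
        by apply: bounded01B; [exact: bounded01_cst | exact: bounded01_below].
      - by apply: bounded01_L1; apply: bounded01D; apply: bounded01Z => //;
        exact: bounded01_cst.
      - apply: ae01_all => s s01; rewrite /below mulr1; have [st|ts] := ltP s t.
          by rewrite subrr mulr0 addr_ge0// mulr_ge0.
        rewrite subr0 mulr1; have [sk|sk] := ltP (1 - k%:R / N%:R) s.
          by apply: le_trans (IH L bL L0 (ex_intro _ B LB) LK s s01 sk) _;
            rewrite lerDl mulr_ge0.
        have -> : (a <= s) && (s <= b).
          rewrite ge_max le_max sk orbT andbT; case/andP: s01 => -> _ /=.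
          by apply: ltW; apply: lt_le_trans ts.
        by rewrite mulr1 (le_trans (LS _ s01 (lt_le_trans tk ts)))// lerDr.
    rewrite int01D in J1; [|exact: bounded01_L1 (bounded01_cst _)|exact: L1Z].
    rewrite (int01Z S LI) (int01_itv a0 ab b1) in J1.
    rewrite int01_cst mulr1 in J1; apply: le_trans (ler_wpM2l C0 J1) _.
    rewrite mulrDr lerD2l.
    have : S * (b - a) <= S * N%:R^-1 by rewrite ler_wpM2l.
    have : C * N%:R^-1 <= 2^-1.
      by rewrite ler_pdivrMr// mulrC ler_pdivlMr// mulrC ltW.
    move=> c1 c2; apply: le_trans (ler_wpM2l C0 c2) _.
    by rewrite mulrCA ler_wpM2l.
  have : S <= K + C * D + S / 2.
    by apply: ge_sup; [case: hS | move=> _ [t [t01 tk] <-]; exact: Lr].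
  by move=> HS; apply: le_trans (LS _ r01 rk) _; lra.
(* One slab more than [N], because the strict inequality would miss [t = 0] with [N] slabs. *)
have [D D0 HD] := H N.+1; exists D => L bL L0 LB LK t t01.
apply: HD => //; case/andP: t01 => t0 _; apply: lt_le_trans t0.
by rewrite subr_lt0 ltr_pdivlMr// mul1r ltr_nat.
Qed.

End Gronwall.

(** * Multiplier tuples *)

Lemma increment_sum (R : realType) (a b c d e : R) :
  - (a - c) = e + (b - d) -> a + b = c + d - e.
Proof. by move=> ?; lra. Qed.

Lemma sum_difference (R : realType) (a b c d : R) :
  a - b = a + c - (b + d) + (- c - - d).
Proof. by lra. Qed.

(** Pointwise algebra behind the identity: the two [fx] terms cancel by transposition, and
    stationarity trades [l^T *m fu] for [- (c *: Lu + z *: gu)]. *)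
Lemma adjoint_pairing (R : realType) (n m : nat) (fx : 'M[R]_n) (fu : 'M[R]_(n, m))
    (Lx gx : 'rV[R]_n) (Lu gu : 'rV[R]_m) (l y p : 'cV[R]_n) (v : 'cV[R]_m) (c z : R) :
  p = fx *m y + fu *m v -> 0 = fu^T *m l + c *: Lu^T + z *: gu^T ->
  \sum_i p i 0 * l i 0
    - \sum_i (fx^T *m l + c *: Lx^T + z *: gx^T) i 0 * y i 0 =
  - c * (Lx *m y + Lu *m v) 0 0 - z * (gx *m y + gu *m v) 0 0.
Proof.
move=> pE ul.
have dot (a b : 'cV[R]_n) : \sum_i a i 0 * b i 0 = (a^T *m b) 0 0.
  by rewrite mxE; apply: eq_bigr => i _; rewrite mxE.
have dotC (a b : 'cV[R]_n) : \sum_i a i 0 * b i 0 = \sum_i b i 0 * a i 0.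
  by apply: eq_bigr => i _; rewrite mulrC.
have lu : l^T *m fu = - (c *: Lu + z *: gu).
  apply/eqP; rewrite -addr_eq0; apply/eqP; apply: trmx_inj.
  by rewrite trmx0 ul !linearD/= !linearZ/= trmx_mul trmxK addrA.
have e (A B : 'M[R]_1) : A 0 0 - B 0 0 = (A - B) 0 0 by rewrite !mxE.
have e' (A B : 'M[R]_1) : - c * A 0 0 - z * B 0 0 = (- c *: A - z *: B) 0 0.
  by rewrite !mxE.
rewrite dotC !dot e e'; congr (fun_of_matrix _ 0 0).
rewrite pE mulmxDr !mulmxA lu !linearD/= !linearZ/= trmx_mul !trmxK.
rewrite !mulmxDl -!scalemxAl !mulNmx.
move: (_ *m fx *m y) (Lu *m v) (gu *m v) (Lx *m y) (gx *m y) => A B D E F.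
by apply/matrixP => i j; rewrite !mxE; ring.
Qed.

Section Multipliers.
Context {R : realType} {n m : nat}.
Variables (P : ocp R n m) (xb : R -> 'cV[R]_n) (ub : R -> 'cV[R]_m).
Hypotheses (smooth : smooth_data P) (adm : admissible P xb ub).

(** Makes the coefficients legitimate integrands for the charge: trajectory and control stay almost
    everywhere in a compact box. *)
Lemma along_admissible_bounded01 (k : R -> 'cV[R]_n -> 'cV[R]_m -> R) :
  jointly_continuous k -> bounded01 (along k xb ub).
Proof.
case: adm => Lu [w xw _] _ _; have [mu [C uC]] := Linfty_bounded Lu.
have [B xB] := has_L1_derivative_bounded xw => kc.
apply: (@along_bounded01 _ _ _ k xb ub (Num.max B C)) => //.
- by move=> i; exact: has_L1_derivative_continuous xw.
- by move=> t i t01; rewrite le_max xB.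
- by apply: ae01_imp uC => t _ ut i; rewrite le_max ut orbT.
Qed.

Lemma along_coord_bounded01 p q (k : R -> 'cV[R]_n -> 'cV[R]_m -> 'M[R]_(p, q)) i j :
  jointly_continuous k -> bounded01 (fun t => along k xb ub t i j).
Proof.
move=> kc; apply: (@along_admissible_bounded01 (fun t a b => k t a b i j)).
exact: jointly_continuous_coord.
Qed.

Let bLx i : bounded01 (fun t => along (cost_x P) xb ub t 0 i).
Proof. by apply: along_coord_bounded01; case: smooth => _ _ []. Qed.

Let bLu i : bounded01 (fun t => along (cost_u P) xb ub t 0 i).
Proof. by apply: along_coord_bounded01; case: smooth => _ _ _ []. Qed.

Let bgx i : bounded01 (fun t => along (cstr_x P) xb ub t 0 i).
Proof. by apply: along_coord_bounded01; case: smooth => _ _ []. Qed.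

Let bgu i : bounded01 (fun t => along (cstr_u P) xb ub t 0 i).
Proof. by apply: along_coord_bounded01; case: smooth => _ _ _ []. Qed.

Let bfx i j : bounded01 (fun t => along (dyn_x P) xb ub t i j).
Proof. by apply: along_coord_bounded01; case: smooth => _ _ []. Qed.

Let bg : bounded01 (along (cstr P) xb ub).
Proof. by apply: along_admissible_bounded01; case: smooth => -[]. Qed.

Lemma adjoint_rateE (w : multiplier) t i : adjoint_rate P xb ub w t i 0 =
  \sum_j along (dyn_x P) xb ub t j i * lam w t j 0
  + lam0 w * along (cost_x P) xb ub t 0 i + mz w t * along (cstr_x P) xb ub t 0 i.
Proof. by rewrite !mxE; under eq_bigr do rewrite mxE. Qed.

Section Tuple.
Variable w : @multiplier R n.
Hypothesis mw : multiplier_tuple P xb ub w.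
Local Notation zeta := (mzeta w).
Local Notation zint := (zint (mzeta w)).
Local Notation rate i := (fun t => adjoint_rate P xb ub w t i 0).
Local Notation gx i := (fun t => along (cstr_x P) xb ub t 0 i).
Local Notation gu i := (fun t => along (cstr_u P) xb ub t 0 i).

Let zba : ba zeta. Proof. by case: mw => _ []. Qed.

Let zpos : positive_charge zeta. Proof. by case: mw => _ []. Qed.

Let zL1 : L1 (mz w). Proof. by case: mw => -[]. Qed.

Let zge0 : ae01 (fun t => 0 <= mz w t). Proof. by case: mw => -[]. Qed.

Let BVl : BV (lam w). Proof. by case: mw => -[]. Qed.

Let BVb : BV (bet w). Proof. by case: mw => -[]. Qed.

Let zl := zint_linear zba zpos.
Let zm := zint_monotone zba zpos.

Lemma rate_L1 i : L1 (rate i).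
Proof.
rewrite (_ : rate i = fun t => \sum_j along (dyn_x P) xb ub t j i * lam w t j 0
  + lam0 w * along (cost_x P) xb ub t 0 i + mz w t * along (cstr_x P) xb ub t 0 i).
  apply: L1D; last exact: L1M.
  apply: bounded01_L1; apply: bounded01D; last exact: bounded01Z.
  by apply: bounded01_sum => j; apply: bounded01M => //; exact: BV_bounded01.
by apply/funext => t; rewrite adjoint_rateE.
Qed.

(* The singular part of [dlam] is [- dbet], so that [lam + bet] is absolutely
   continuous: only this consequence of the adjoint equation is needed. *)
Lemma adjoint_primitive i (t : R) : 0 <= t <= 1 ->
  lam w t i 0 + bet w t i 0 = int01 (fun s => rate i s * (1 - below t s)).
Proof.
move=> t01; have Lr := rate_L1 i; have lr := linear01_int01 Lr.
case: mw => _ _ _ _ [[l1 b1] /(_ i)[dl [db [sl sb H]]] _ _ _].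
(* Stieltjes masses are prescribed only for [0 < r]. Taking [r = 1], where [lam] and [bet] vanish,
   identifies the value at 0 and turns the primitive from 0 into a tail up to 1. *)
have key (r : R) : 0 < r <= 1 ->
    lam w r i 0 + bet w r i 0 = lam w 0 i 0 + bet w 0 i 0
      - int01 (fun s => rate i s * below r s).
  move=> /andP[r0 r1].
  have r01 : 0 <= r <= 1 by rewrite ltW.
  have := H `[0, r]%classic (measurable_itv _) _.
  rewrite sl ?r0// sb ?r0//.
  have LA : (@Leb R).-integrable `[0, r] (EFin \o rate i).
    apply: integrableS Lr; [exact: measurable_I01 | exact: leb_measurable_itv |].
    by apply: subset_itv; rewrite bnd_simp.
  rewrite -(fineK (integrable_fin_num _ LA)); last exact: leb_measurable_itv.
  rewrite -EFinN -EFinD => E.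
  rewrite -(int01_initial Lr r01).
  have {}E : - (lam w r i 0 - lam w 0 i 0) =
      \int[@Leb R]_(s in `[0, r]) rate i s + (bet w r i 0 - bet w 0 i 0).
    by apply: EFin_inj; apply: E; apply: subset_itv; rewrite bnd_simp.
  exact: increment_sum E.
have below1 : int01 (fun s => rate i s * below 1 s) = int01 (rate i).
  apply: ae_eq_int01; first by apply: L1M => //; exact: bounded01_below.
  apply: ae01_imp (ae01_neq 1) => s /andP[_ s1] sn.
  by rewrite /below lt_neqAle sn s1 mulr1.
have k1 := key 1; rewrite ltr01 lexx l1 b1 !mxE below1 in k1.
have -> : lam w t i 0 + bet w t i 0 = int01 (rate i) - int01 (fun s => rate i s * below t s).
  have [->|t0] := eqVneq t 0.
    have -> : int01 (fun s => rate i s * below 0 s) = 0.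
      rewrite -[RHS](linear01_0 lr); apply: ae_eq_int01.
        by apply: L1M => //; exact: bounded01_below.
      apply: ae01_all => s /andP[s0 _]; by rewrite /below ltNge s0.
    by rewrite subr0; apply/eqP; rewrite -subr_eq0 -(k1 isT) addr0.
  have /eqP := k1 isT; rewrite addr0 eq_sym subr_eq0 => /eqP <-.
  by case/andP: t01 => t0' t1; apply: key; rewrite lt_neqAle eq_sym t0 t0'.
rewrite -{1}(_ : (fun s => rate i s * 1) = rate i); last by apply/funext => s;
  rewrite mulr1.
by rewrite -(linear01B lr) //; [exact: bounded01_cst | exact: bounded01_below].
Qed.

Lemma bet_limit i (t : R) : 0 <= t <= 1 ->
  zint (fun s => gx i s * (1 - below (shift k t) s)) @[k --> \oo] --> - bet w t i 0.
Proof.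
move=> t01; case: mw => _ _ _ _ [[_ b1] _ /(_ i)[b0 bt] _ _].
have bb (c : R) : bounded01 (fun s => gx i s * (1 - below c s)).
  apply: bounded01M => //.
  by apply: bounded01B; [exact: bounded01_cst | exact: bounded01_below].
have [->|t0] := eqVneq t 0.
  rewrite b0 opprK /shift eqxx charge_integralE.
  rewrite (_ : zint (fun s => gx i s * (1 - below 0 s)) =
    zint (fun s => gx i s * (s \in I01)%:R)); first exact: cvg_cst.
  apply: zint_ae => //.
    by apply: bounded01M => //; apply: bounded01_ind; exact: measurable_I01.
  apply: ae01_all => s s01; rewrite /below ltNge; case/andP: (s01) => -> _.
  by rewrite mem_set ?subr0//; exact/I01P.
have [->|t1] := eqVneq t 1.
  rewrite b1 mxE oppr0.
  rewrite (_ : (fun k => _) = fun=> 0); first exact: cvg_cst.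
  apply/funext => k; rewrite -[RHS](linear01_0 zl); apply: zint_ae => //.
    exact: bounded01_cst.
  apply: ae01_all => s /andP[_ s1]; rewrite /below /shift oner_eq0.
  by rewrite (le_lt_trans s1) ?subrr ?mulr0// ltrDl invr_gt0.
have t01' : 0 < t < 1 by rewrite !lt_neqAle eq_sym t0 t1.
rewrite (_ : (fun k => _) = fun k => - - charge_integral zeta `[t + k.+1%:R^-1, 1] (gx i)).
  by apply: cvgN; exact: bt.
apply/funext => k; rewrite opprK charge_integralE; apply: zint_ae => //.
  by apply: bounded01M => //; apply: bounded01_ind; exact: leb_measurable_itv.
apply: ae01_all => s /andP[_ s1]; congr (_ * _).
rewrite mem_setE in_itv/= s1 andbT /below /shift (negbTE t0).
by case: ltP; rewrite ?subrr ?subr0.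
Qed.

Lemma zeta_fin : zeta I01 \is a fin_num.
Proof. by apply: fin_num_measure; exact: measurable_I01. Qed.

Lemma L1_norm_mz : L1_norm (mz w) = (int01 (mz w))%:E.
Proof.
rewrite (L1_normE zL1); congr EFin; apply: ae_eq_int01; first exact: L1_abs.
by apply: ae01_imp zge0 => t _ zt; rewrite ger0_norm.
Qed.

Lemma zint_cst1 : zint (fun=> 1) = fine (zeta I01).
Proof.
rewrite -(fine_charge_setT zba) -(zint_indic zba zpos measurableT).
by congr (zint _); apply/funext => t; rewrite in_setT.
Qed.

Lemma bet_variation (K : 'I_n -> R) : (forall i, 0 <= K i) ->
  (forall i, ae01 (fun t => `|gx i t| <= K i)) ->
  (vvariation (bet w) <= (\sum_i K i * fine (zeta I01))%:E)%E.
Proof.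
move=> K0 gK; apply: vvariation_le => s ps i.
have := tail_variation zba zpos (bgx i) (K0 i) (gK i) (@bet_limit i) ps.
rewrite zint_cst1; apply: le_trans; apply: ler_sum => p _.
by rewrite -opprD normrN.
Qed.

(** Supplies [qE] for the density [rate], with integration against its absolute value as the
    dominating functional; here [lam + bet] is an exact tail. *)
Lemma lam_bet_tail i (a t b : R) : 0 <= a -> a <= t -> t < b -> t <= 1 ->
  `|lam w t i 0 + bet w t i 0 - int01 (fun s => rate i s * (1 - below a s))|
    <= int01 (fun s => `|rate i s| * (below b s - below a s)).
Proof.
move=> a0 at_ tb t1; have t01 : 0 <= t <= 1 by rewrite (le_trans a0).
have Lr := rate_L1 i; have lr := linear01_int01 Lr.
have b1 (c : R) : bounded01 (fun s => 1 - below c s).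
  by apply: bounded01B; [exact: bounded01_cst | exact: bounded01_below].
have bB (c d : R) : bounded01 (fun s => below c s - below d s).
  by apply: bounded01B; exact: bounded01_below.
rewrite (adjoint_primitive i t01) -(linear01B lr)//.
apply: le_trans (int01_dominated Lr _) _; first exact: bounded01B.
apply: (monotone01_int01 Lr) => //; first by apply: bounded01_abs; exact: bounded01B.
apply: ae01_all => s _; rewrite /below.
have [sa|as_] := ltP s a.
  have sb := lt_le_trans sa (le_trans at_ (ltW tb)).
  by rewrite (lt_le_trans sa at_) sb !subrr normr0.
have [st|ts] := ltP s t; last by rewrite !subr0 subrr normr0.
by rewrite (lt_trans st tb) !subr0 subrr sub0r normrN normr1.
Qed.

Lemma bet_bound i (K : R) (t : R) : 0 <= K ->
  ae01 (fun t => `|gx i t| <= K) -> 0 <= t <= 1 ->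
  `|bet w t i 0| <= K * fine (zeta I01).
Proof.
move=> K0 gK t01; rewrite -normrN -zint_cst1.
apply: (ler_cvg_to (cvg_norm (@bet_limit i t t01)) (cvg_cst _)).
apply: nearW => k.
have b1 : bounded01 (fun s => 1 - below (shift k t) s).
  by apply: bounded01B; [exact: bounded01_cst | exact: bounded01_below].
apply: le_trans (zint_weight_dominated zba zpos (bgx i) gK b1) _.
rewrite ler_wpM2l//; apply: zm.
- exact: bounded01_abs.
- exact: bounded01_cst.
- apply: ae01_all => s _; rewrite /below.
  by case: (s < _); rewrite ?subrr ?subr0 ?normr0 ?normr1.
Qed.

(** For a positive charge the sum is the integral of a sum of indicators of disjoint sets, hence of
    a function at most 1. *)
Lemma ba_norm_le : (ba_norm zeta <= zeta I01)%E.
Proof.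
apply: ge_ereal_sup => _ [k [E [mE EI tE ->]]].
rewrite -(fineK zeta_fin).
have -> : (\sum_i `|zeta (E i)|)%E = (\sum_i fine (zeta (E i)))%:E.
  rewrite -sumEFin; apply: eq_bigr => i _.
  by rewrite charge_fineK// gee0_abs// zpos.
rewrite lee_fin -zint_cst1.
under eq_bigr => i _ do rewrite -(zint_indic zba zpos (mE i)).
have bE i : bounded01 (fun t => (t \in E i)%:R) by exact: bounded01_ind.
rewrite -(linear01_sum _ zl)//; apply: zm; [exact: bounded01_sum|exact: bounded01_cst|].
apply: ae01_all => t _.
have [[i tEi]|none] := pselect (exists i, E i t).
  rewrite (bigD1 i)//= big1 ?addr0 ?lern1 ?leq_b1// => j ji.
  rewrite memNset// => tEj; move/eqP: ji; apply.
  by apply: tE => //; exists t.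
by rewrite big1// => i _; rewrite memNset// => tEi; apply: none; exists i.
Qed.

(** Split [lam] as [(lam + bet) - bet]: the first part has variation at most the L1 norm of [rate],
    the second at most [K] times the total charge. *)
Lemma lam_variation (V : 'I_n -> R) :
  (forall i, int01 (fun t => `|rate i t|) <= V i) ->
  forall K : 'I_n -> R, (forall i, 0 <= K i) ->
  (forall i, ae01 (fun t => `|gx i t| <= K i)) ->
  (vvariation (lam w) <= (\sum_i (V i + K i * fine (zeta I01)))%:E)%E.
Proof.
move=> rV K K0 gK; apply: vvariation_le => s ps i.
have Lr := rate_L1 i; have Lar := L1_abs Lr.
have lr := linear01_int01 Lr; have lar := linear01_int01 Lar.
have bv_ := tail_variation zba zpos (bgx i) (K0 i) (gK i) (@bet_limit i) ps.
rewrite zint_cst1 in bv_.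
have b1 (c : R) : bounded01 (fun s => 1 - below c s).
  by apply: bounded01B; [exact: bounded01_cst | exact: bounded01_below].
pose H t := int01 (fun r => `|rate i r| * below t r).
pose T t := int01 (fun r => rate i r * (1 - below t r)).
have TH b c : 0 <= b -> b <= c -> `|T c - T b| <= H c - H b.
  move=> _ bc; rewrite /H /T.
  rewrite -(linear01B lr (b1 c) (b1 b)).
  rewrite -(linear01B lar (bounded01_below c) (bounded01_below b)).
  apply: le_trans (int01_dominated Lr _) _; first exact: bounded01B.
  apply: (monotone01_int01 Lr); first by apply: bounded01_abs; exact: bounded01B.
    by apply: bounded01B; exact: bounded01_below.
  apply: ae01_all => r _; rewrite /below; have [rb|br] := ltP r b.
    by rewrite (lt_le_trans rb bc) !subrr normr0.
  by case: (r < c); rewrite !subr0 ?subrr ?sub0r ?normrN ?normr1 ?normr0.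
case: (ps) => ps1 /eqP ls.
have HS := @sum_zip_le R (fun p => `|T p.2 - T p.1|) H 0 s (lexx _) TH ps1.
have H1 : H (last 0 s) - H 0 <= V i.
  apply: le_trans (rV i).
  rewrite ls /H -(linear01B lar (bounded01_below 1) (bounded01_below 0)).
  apply: le_int01 => //.
    by apply: L1M => //; apply: bounded01B; exact: bounded01_below.
  apply: ae01_all => r _; rewrite ler_piMr// /below.
  by case: (r < 1); case: (r < 0);
    rewrite ?subrr ?subr0 ?sub0r// -subr_ge0 opprK addr_ge0.
apply: le_trans (lerD (le_trans HS H1) bv_).
rewrite -big_split/= big_seq [leRHS]big_seq; apply: ler_sum => p ps2.
have [p1 p2] : 0 <= p.1 <= 1 /\ 0 <= p.2 <= 1.
  by have := zip_path ps1 ps2; rewrite ls.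
rewrite /T -(adjoint_primitive i p1) -(adjoint_primitive i p2).
apply: le_trans (ler_normD _ _); rewrite le_eqVlt; apply/orP; left; apply/eqP.
congr (`|_|); exact: sum_difference.
Qed.

(** * Testing a multiplier tuple against the linearised direction *)

Section Direction.
Variables (y : R -> 'cV[R]_n) (v : R -> 'cV[R]_m) (eps delta : R).
Hypotheses (eps0 : 0 < eps) (Lv : Linfty v).
Hypothesis yode : ode y (fun t => along (dyn_x P) xb ub t *m y t
  + along (dyn_u P) xb ub t *m v t).
Hypothesis y0 : y 0 = 0.
Local Notation gdir :=
  (fun t => (along (cstr_x P) xb ub t *m y t + along (cstr_u P) xb ub t *m v t) 0 0).
Local Notation Ldir :=
  (fun t => (along (cost_x P) xb ub t *m y t + along (cost_u P) xb ub t *m v t) 0 0).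

Let bv j : bounded01 (fun t => v t j 0).
Proof.
have [mv [C vC]] := Linfty_bounded Lv; split => //.
by exists C; apply: ae01_imp vC => t _; apply.
Qed.

Let by_ i : bounded01 (fun t => y t i 0).
Proof. by case: yode => wy ywy _; exact: has_L1_derivative_bounded01 ywy. Qed.

Let bdir (a : R -> 'rV[R]_n) (b : R -> 'rV[R]_m) :
  (forall i, bounded01 (fun t => a t 0 i)) -> (forall j, bounded01 (fun t => b t 0 j)) ->
  bounded01 (fun t => (a t *m y t + b t *m v t) 0 0).
Proof.
move=> ba_ bb; under eq_fun do rewrite !mxE.
by apply: bounded01D; apply: bounded01_sum => i; exact: bounded01M.
Qed.

Let bgdir : bounded01 gdir. Proof. exact: bdir. Qed.

Lemma cost_direction_bounded01 : bounded01 Ldir.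
Proof. exact: bdir. Qed.

Lemma direction_identity :
  zint gdir + int01 (fun t => mz w t * gdir t) = - (lam0 w * int01 Ldir).
Proof.
have [wy ywy wyE] := yode.
have Lwy i : L1 (fun t => wy t i 0) by case: ywy.
have bl i : bounded01 (fun t => lam w t i 0) by exact: BV_bounded01.
have bb i : bounded01 (fun t => bet w t i 0) by exact: BV_bounded01.
have yE i (t : R) : 0 <= t <= 1 -> y t i 0 = int01 (fun s => wy s i 0 * below t s).
  by move=> t01; rewrite (has_L1_derivativeE i ywy t01) y0 mxE add0r.
(* The exchange lemma with the functional of density [rate], which replaces an integration by
   parts. *)
have p1 i : int01 (fun t => wy t i 0 * (lam w t i 0 + bet w t i 0)) =
    int01 (fun t => rate i t * y t i 0).
  have Lr := rate_L1 i.
  apply: (@exchange_integrals _ _ (fun h => int01 (fun t => rate i t * h t))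
    (fun h => int01 (fun t => `|rate i t| * h t)) (fun t => y t i 0)
    (fun t => lam w t i 0 + bet w t i 0)) => //.
  - exact: linear01_int01.
  - by apply: linear01_int01; exact: L1_abs.
  - exact: monotone01_int01.
  - by move=> h bh; exact: int01_dominated.
  - exact: bounded01D.
  - by move=> t; exact: yE.
  - by move=> a t b; exact: lam_bet_tail.
(* The same lemma for the charge weighted by [gx i], dominated by [|K|] times the charge itself. *)
have p2 i : int01 (fun t => wy t i 0 * - bet w t i 0) = zint (fun t => gx i t * y t i 0).
  have [_ [K gK]] := bgx i.
  have gK' : ae01 (fun t => `|gx i t| <= `|K|).
    by apply: ae01_imp gK => t _ /le_trans; apply; exact: ler_norm.
  apply: (@exchange_integrals _ _ (fun h => zint (fun t => gx i t * h t))
    (fun h => `|K| * zint h) (fun t => y t i 0) (fun t => - bet w t i 0)) => //.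
  - exact: zint_weight_linear.
  - exact: zint_scale_linear.
  - exact: zint_scale_monotone.
  - by move=> h bh; exact: zint_weight_dominated.
  - by under eq_fun do rewrite -mulN1r; exact: bounded01Z.
  - by move=> t; exact: yE.
  - by move=> a t b a0 at_ tb t1; 
    exact: (tail_limit zba zpos (bgx i) (normr_ge0 K) gK' (@bet_limit i) a0 at_ tb t1).
have bl_ i : bounded01 (fun t => lam w t i 0) by exact: BV_bounded01.
(* Adding [p1] and [p2] cancels [bet] and leaves the costate [lam] alone against [y']. *)
have sum1 : int01 (fun t => \sum_i wy t i 0 * lam w t i 0) =
    int01 (fun t => \sum_i rate i t * y t i 0) + \sum_i zint (fun t => gx i t * y t i 0).
  rewrite !int01_sum; [|by move=> i; apply: L1M => //; exact: rate_L1|by move=> i;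
    exact: L1M].
  rewrite -big_split/=; apply: eq_bigr => i _; rewrite -p1 -p2 -int01D.
  - by congr int01; apply/funext => t; rewrite mulrDr mulrN addrK.
  - by apply: L1M => //; exact: bounded01D.
  - by apply: L1M => //; under eq_fun do rewrite -mulN1r; exact: bounded01Z.
have gu0 : zint (fun t => \sum_j gu j t * v t j 0) = 0.
  rewrite (linear01_sum _ zl); last by move=> j; exact: bounded01M.
  apply: big1 => j _; have [_ [K gK]] := bgu j.
  have gK' : ae01 (fun t => `|gu j t| <= `|K|).
    by apply: ae01_imp gK => t _ /le_trans; apply; exact: ler_norm.
  apply: (zint_weight_eq0 zba zpos (bgu j) (normr_ge0 K) gK' (bv j)) => E mE EI.
  by case: mw => _ _ _ _ [_ _ _ _]; exact.
have -> : zint gdir = \sum_i zint (fun t => gx i t * y t i 0).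
  rewrite (_ : gdir = fun t => \sum_i gx i t * y t i 0 + \sum_j gu j t * v t j 0).
    rewrite (linear01D zl) ?gu0 ?addr0 ?(linear01_sum _ zl)//.
    - by move=> i; exact: bounded01M.
    - by apply: bounded01_sum => i; exact: bounded01M.
    - by apply: bounded01_sum => j; exact: bounded01M.
  by apply/funext => t; rewrite !mxE.
have pairing : ae01 (fun t => \sum_i wy t i 0 * lam w t i 0 =
    \sum_i rate i t * y t i 0 + ((- lam0 w) * Ldir t + (-1) * (mz w t * gdir t))).
  have uE : ae01 (fun t => 0 = (along (dyn_u P) xb ub t)^T *m lam w t
      + lam0 w *: (along (cost_u P) xb ub t)^T + mz w t *: (along (cstr_u P) xb ub t)^T).
    by case: mw => _ _ _ _ [].
  apply: ae01_imp (ae01_and wyE uE) => t _ [wyt ut].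
  apply/eqP; rewrite addrC -subr_eq mulN1r; apply/eqP.
  exact: (adjoint_pairing _ _ wyt ut).
have Lz : L1 (fun t => mz w t * gdir t) by exact: L1M.
have LL : L1 Ldir := bounded01_L1 cost_direction_bounded01.
have sum2 : int01 (fun t => \sum_i wy t i 0 * lam w t i 0) =
    int01 (fun t => \sum_i rate i t * y t i 0)
    + ((- lam0 w) * int01 Ldir + (-1) * int01 (fun t => mz w t * gdir t)).
  rewrite -int01Z// -int01Z// -int01D; [|exact: L1Z|exact: L1Z].
  rewrite -int01D; [| |by apply: L1D; exact: L1Z]; last first.
    by apply: L1_sum => i; apply: L1M => //; exact: rate_L1.
  by apply: ae_eq_int01 => //; apply: L1_sum => i; exact: L1M.
(* The integral of [rate] against [y] is common to both evaluations and drops out, taking the whole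
   of [fx] and [lam] with it. *)
move: sum2; rewrite sum1 => /addrI ->.
by rewrite mulN1r subrK mulNr.
Qed.

Hypothesis delta0 : 0 < delta.
Hypothesis decrease : ae01 (fun t => - eps <= along (cstr P) xb ub t ->
  gdir t <= - delta).

(** [zint] is monotone for inequalities that hold Lebesgue almost everywhere, but [gdir <= - delta]
    may fail on [A], a set of zero charge that need not be Lebesgue null. The comparison function is
    therefore raised on [A], at no cost for its integral. *)
Lemma zint_gdir_le : zint gdir <= - delta * fine (zeta I01).
Proof.
have [_ [K gK]] := bgdir.
pose A : set (LebR R) := I01 `&` [set t | eps / 2 < `|along (cstr P) xb ub t|].
have mA : measurable A.
  have mabs := measurableT_comp (@normr_measurable R setT) bg.1.
  rewrite /A (_ : [set t | _] = (fun t => `|along (cstr P) xb ub t|) @^-1` `]eps / 2, +oo[).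
    by apply: mabs; [exact: measurable_I01 | exact: measurable_itv].
  by apply/seteqP; split => t /=; rewrite in_itv/= andbT.
have zA : fine (zeta A) = 0.
  case: mw => _ _ _ [_ /(_ (eps / 2))] + _; rewrite divr_gt0// => /(_ isT) H.
  by rewrite H.
have bI := bounded01_ind mA.
have bK : bounded01 (fun t => (`|K| + delta) * (t \in A)%:R) by exact: bounded01Z.
have b1 := bounded01_cst (1 : R).
(* On [A] the height [|K| + delta] lifts the comparison function to [|K|], which bounds [gdir]; off
   [A], [|g| <= eps / 2] puts [t] in the region of decrease. *)
have -> : - delta * fine (zeta I01) =
    zint (fun t => - delta * 1 + (`|K| + delta) * (t \in A)%:R).
  rewrite (zl _ b1 bK) (linear01Z _ zl bI) (zint_indic zba zpos mA) zA -zint_cst1.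
  by rewrite mulr0 addr0.
apply: zm => //; first by apply: bounded01D => //; exact: bounded01Z.
apply: ae01_imp (ae01_and decrease gK) => t t01 [dt Kt]; rewrite mulr1.
have [tA|tA] := boolP (t \in A).
  rewrite mulr1 addrCA addNr addr0.
  exact: le_trans (ler_norm _) (le_trans Kt (ler_norm _)).
rewrite mulr0 addr0; apply: dt; move: tA; rewrite notin_setE => tA.
rewrite lerNl leNgt; apply/negP => egt; apply: tA; split; first exact/I01P.
rewrite /= -normrN; apply: lt_le_trans (ler_norm _); apply: le_lt_trans egt.
by rewrite ler_pdivrMr// ler_peMr ?ler1n// ltW.
Qed.

(** Outside the region of decrease the constraint is below [- eps], hence nonzero, and
    complementarity forces [mz w] to vanish. *)
Lemma int01_gdir_le : int01 (fun t => mz w t * gdir t) <= - delta * int01 (mz w).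
Proof.
rewrite -int01Z//; apply: le_int01; [exact: L1M | exact: L1Z |].
have comp : ae01 (fun t => mz w t * along (cstr P) xb ub t = 0).
  by case: mw => _ _ _ [].
apply: ae01_imp (ae01_and (ae01_and decrease zge0) comp) => t _ [[dt zt]].
have [gt|gt] := leP (- eps) (along (cstr P) xb ub t) => /eqP.
  by rewrite [- delta * _]mulrC ler_wpM2l// dt.
rewrite mulf_eq0 => /orP[/eqP ->|/eqP g0]; first by rewrite mul0r mulr0.
by move: gt; rewrite g0 oppr_gt0 ltNge (ltW eps0).
Qed.

Lemma multiplier_bound :
  delta * (int01 (mz w) + fine (zeta I01)) <= lam0 w * int01 (fun t => `|Ldir t|).
Proof.
have l0 : 0 <= lam0 w by case: mw => -[].
have LL : L1 Ldir := bounded01_L1 cost_direction_bounded01.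
have JL : int01 Ldir <= int01 (fun t => `|Ldir t|).
  by apply: le_int01 => //; [exact: L1_abs|apply: ae01_all => t _; exact: ler_norm].
have H := direction_identity.
apply: le_trans (ler_wpM2l l0 JL).
rewrite -lerN2 -H mulrDr opprD addrC -!mulNr.
exact: lerD int01_gdir_le zint_gdir_le.
Qed.

Lemma multiplier_lam0_gt0 : 0 < lam0 w.
Proof.
have : 0 <= lam0 w by case: mw => -[].
rewrite le_eqVlt => /orP[/eqP l0|//].
have Jz0 : 0 <= int01 (mz w).
  rewrite -(int01_cst 0); apply: le_int01 => //; exact: bounded01_L1 (bounded01_cst 0).
have Z0 : 0 <= fine (zeta I01).
  by apply: fine_charge_ge0 => //; exact: measurable_I01.
have := multiplier_bound; rewrite -l0 mul0r pmulr_rle0// => S0.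
have : (0 < (lam0 w)%:E + L1_norm (mz w) + zeta I01)%E by case: mw.
rewrite L1_norm_mz -(fineK zeta_fin) -l0 -!EFinD lte_fin add0r => S1.
by have := lt_le_trans S1 S0; rewrite ltxx.
Qed.

End Direction.

End Tuple.

(** * Uniform bounds for normalised tuples *)

Lemma bounded01_uniform (I : finType) (f : I -> R -> R) :
  (forall i, bounded01 (f i)) ->
  exists2 K : R, 0 <= K & forall i, ae01 (fun t => `|f i t| <= K).
Proof.
move=> bf; have [K fK] := choice (fun i => (bf i).2).
exists (\sum_i `|K i|) => [|i]; first exact: sumr_ge0.
apply: ae01_imp (fK i) => t _ /le_trans; apply; apply: le_trans (ler_norm _) _.
by rewrite (bigD1 i)//= lerDl sumr_ge0.
Qed.

(** With [lam0 w = 1], each component of the rate is at most [a * L + c + k * mz w]. Writing [lam]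
    as tail minus [bet] yields the integral inequality of [gronwall], whose data depend on [B] and
    the coefficients only. *)
Lemma lam_uniform_bound (B : R) : 0 <= B -> exists D V : R,
  forall w : multiplier, multiplier_tuple P xb ub w -> lam0 w = 1 ->
  int01 (mz w) + fine (mzeta w I01) <= B ->
  (forall t : R, 0 <= t <= 1 -> \sum_i `|lam w t i 0| <= D) /\
  (vvariation (lam w) <= V%:E)%E.
Proof.
move=> B0.
have [a a0 fa] := bounded01_uniform (fun p : 'I_n * 'I_n => bfx p.1 p.2).
have [c c0 Lc] := bounded01_uniform bLx.
have [k k0 gk] := bounded01_uniform bgx.
(* Per component: [c] from the cost, one [k * B] from [mz] in the rate and one from the bound on
   [bet]. *)
pose K := \sum_(i < n) (c + k * B + k * B).
have K0 : 0 <= K by apply: sumr_ge0 => i _; rewrite !addr_ge0// mulr_ge0.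
have A0 : 0 <= \sum_(i < n) a by exact: sumr_ge0.
have [D HD] := gronwall A0 K0.
exists D, (\sum_(i < n) ((a * D + (c + k * B)) + k * B)) => w mw l0 wB.
have [[_ Lz z0 BVl BVb] [zba zpos _] _ _ _] := mw.
have Jz0 : 0 <= int01 (mz w).
  by rewrite -(int01_cst 0); apply: le_int01 => //;
    exact: bounded01_L1 (bounded01_cst 0).
have Z0 : 0 <= fine (mzeta w I01).
  by apply: fine_charge_ge0 => //; exact: measurable_I01.
have JzB : int01 (mz w) <= B by apply: le_trans wB; rewrite lerDl.
have ZB : fine (mzeta w I01) <= B by apply: le_trans wB; rewrite lerDr.
pose L t := \sum_i `|lam w t i 0|.
have bL : bounded01 L.
  by apply: bounded01_sum => i; apply: bounded01_abs; exact: BV_bounded01.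
have Lrate i : L1 (fun t => adjoint_rate P xb ub w t i 0) by exact: rate_L1.
have LL : L1 L by exact: bounded01_L1.
have Lck : L1 (fun t => c + k * mz w t).
  by apply: L1D; [exact: bounded01_L1 (bounded01_cst c) | exact: L1Z].
have Jck : int01 (fun t => c + k * mz w t) <= c + k * B.
  rewrite int01D; [|exact: bounded01_L1 (bounded01_cst c)|exact: L1Z].
  by rewrite int01_cst int01Z// lerD2l ler_wpM2l.
have rate_le i : ae01 (fun t => `|adjoint_rate P xb ub w t i 0|
    <= a * L t + (c + k * mz w t)).
  have fai : ae01 (fun t => forall j, `|along (dyn_x P) xb ub t j i| <= a).
    have : \forall t \ae @Leb R, forall j : 'I_n, I01 t ->
        `|along (dyn_x P) xb ub t j i| <= a.
      by apply: filter_forall => j; exact: (fa (j, i)).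
    by rewrite /ae01; apply: filterS => t H It j; exact: H.
  apply: ae01_imp (ae01_and (ae01_and fai z0) (ae01_and (Lc i) (gk i))).
  move=> t _ [[ft zt] [Lt gt]]; rewrite adjoint_rateE l0 mul1r -addrA.
  apply: le_trans (ler_normD _ _) _; apply: lerD.
    rewrite mulr_sumr; apply: le_trans (ler_norm_sum _ _ _) _.
    by apply: ler_sum => j _; rewrite normrM ler_wpM2r.
  apply: le_trans (ler_normD _ _) _; apply: lerD => //.
  by rewrite normrM mulrC (ger0_norm zt) ler_wpM2r.
have LD (t : R) : 0 <= t <= 1 -> L t <= D.
  apply: HD => //.
  - by move=> r; exact: sumr_ge0.
  - have [C lC] := BV_bounded BVl; exists (\sum_(i < n) C) => r r01.
    by apply: ler_sum => i _; exact: lC.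
  move=> r r01.
  have b1 : bounded01 (fun s => 1 - below r s).
    by apply: bounded01B; [exact: bounded01_cst | exact: bounded01_below].
  rewrite /K mulr_suml -big_split/=; apply: ler_sum => i _.
  rewrite -[lam w r i 0](addrK (bet w r i 0)) (adjoint_primitive mw i r01).
  apply: le_trans (ler_normB _ _) _; rewrite addrAC lerD//; last first.
    apply: le_trans (bet_bound mw k0 (gk i) r01) _.
    by rewrite ler_wpM2l.
  apply: le_trans (int01_dominated (Lrate i) b1) _.
  apply: (@le_trans _ _ (int01 (fun s => a * (L s * (1 - below r s)) + (c + k * mz w s)))).
    apply: le_int01.
    - by apply: L1M; [exact: L1_abs | exact: bounded01_abs].
    - by apply: L1D => //; apply: L1Z; exact: L1M.
    apply: ae01_imp (ae01_and (rate_le i) z0) => s _ [rs zs]; rewrite /below.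
    case: (s < r); rewrite ?subrr ?subr0 ?normr0 ?normr1 ?mulr0 ?mulr1 ?add0r//.
    by rewrite addr_ge0// mulr_ge0.
  rewrite int01D//; last by apply: L1Z; exact: L1M.
  by rewrite (int01Z a (L1M LL b1)) [leRHS]addrC lerD2l; exact: Jck.
split=> //.
apply: le_trans (@lam_variation w mw (fun i => a * D + (c + k * B)) _ (fun=> k) (fun=> k0) gk) _.
  move=> i; apply: (@le_trans _ _ (int01 (fun t => a * L t + (c + k * mz w t)))).
    by apply: le_int01 => //; [exact: L1_abs | apply: L1D => //; exact: L1Z].
  rewrite int01D ?int01Z//; last exact: L1Z.
  apply: lerD => //; rewrite ler_wpM2l// -[leRHS]int01_cst; apply: le_int01 => //.
    exact: bounded01_L1 (bounded01_cst D).
  by apply: ae01_all => t; exact: LD.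
by rewrite lee_fin; apply: ler_sum => i _; rewrite lerD2l ler_wpM2l.
Qed.

Lemma multiplier_norm_bound (B : R) : exists M : R,
  forall w : multiplier, multiplier_tuple P xb ub w -> lam0 w = 1 ->
  int01 (mz w) + fine (mzeta w I01) <= B -> (multiplier_norm w <= M%:E)%E.
Proof.
(* The masses are nonnegative, so no tuple qualifies for a negative [B]. *)
have [B0|B0] := leP 0 B; last first.
  exists 0 => w mw _ wB; exfalso.
  have [[_ Lz z0 _ _] [zba zpos _] _ _ _] := mw.
  have Jz0 : 0 <= int01 (mz w).
    by rewrite -(int01_cst 0); apply: le_int01 => //;
      exact: bounded01_L1 (bounded01_cst 0).
  have Z0 : 0 <= fine (mzeta w I01).
    by apply: fine_charge_ge0 => //; exact: measurable_I01.
  by have := le_lt_trans (addr_ge0 Jz0 Z0) (le_lt_trans wB B0); rewrite ltxx.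
have [D [V DV]] := lam_uniform_bound B0.
have [k k0 gk] := bounded01_uniform bgx.
(* In the order of [multiplier_norm]: initial value and variation of [lam], the same for [bet], then
   [lam0 w = 1], the L1 norm and the charge norm. *)
exists (D + V + (\sum_(i < n) k * B + \sum_(i < n) k * B) + 1 + B + B) => w mw l0 wB.
have [lD lV] := DV w mw l0 wB.
have [[_ Lz z0 _ _] [zba zpos _] _ _ _] := mw.
have Jz0 : 0 <= int01 (mz w).
  by rewrite -(int01_cst 0); apply: le_int01 => //;
    exact: bounded01_L1 (bounded01_cst 0).
have Z0 : 0 <= fine (mzeta w I01).
  by apply: fine_charge_ge0 => //; exact: measurable_I01.
have JzB : int01 (mz w) <= B by apply: le_trans wB; rewrite lerDl.
have ZB : fine (mzeta w I01) <= B by apply: le_trans wB; rewrite lerDr.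
have t00 : 0 <= (0 : R) <= 1 by rewrite lexx ler01.
rewrite /multiplier_norm !EFinD; apply: leeD; [apply: leeD; [apply: leeD;
  [apply: leeD|]|]|].
- apply: leeD => //; rewrite lee_fin; apply: le_trans (enorm_le_sum _) _; exact: lD.
- apply: leeD.
    rewrite lee_fin; apply: le_trans (enorm_le_sum _) _; apply: ler_sum => i _.
    by apply: le_trans (bet_bound mw k0 (gk i) t00) _; rewrite ler_wpM2l.
  apply: le_trans (bet_variation mw (fun=> k0) gk) _.
  by rewrite lee_fin; apply: ler_sum => i _; rewrite ler_wpM2l.
- by rewrite l0 normr1.
- by rewrite (L1_norm_mz mw) lee_fin.
- apply: le_trans (ba_norm_le mw) _.
  by rewrite -(fineK (zeta_fin w)) lee_fin.
Qed.

End Multipliers.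

Theorem theorem4p8 (R : realType) (n m : nat) (P : ocp R n m)
    (xb : R -> 'cV[R]_n) (ub : R -> 'cV[R]_m)
    (eps delta : R) (y : R -> 'cV[R]_n) (v : R -> 'cV[R]_m) :
  smooth_data P ->
  weak_local_minimizer P xb ub ->
  0 < eps -> 0 < delta ->
  Linfty v ->
  ode y (fun t => along (dyn_x P) xb ub t *m y t + along (dyn_u P) xb ub t *m v t) ->
  y 0 = 0 ->
  ae01 (fun t => - eps <= along (cstr P) xb ub t ->
    (along (cstr_x P) xb ub t *m y t + along (cstr_u P) xb ub t *m v t) 0 0
      <= - delta) ->
  (forall w : multiplier, multiplier_tuple P xb ub w ->
     0 < lam0 w /\
     (L1_norm (mz w) + mzeta w I01 <=
        (lam0 w / delta)%:E *
        \int[@Leb R]_(t in I01)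
          `|((along (cost_x P) xb ub t *m y t
              + along (cost_u P) xb ub t *m v t) 0 0)%:E|)%E) /\
  (exists M : R, forall w : multiplier, multiplier_tuple P xb ub w ->
     lam0 w = 1 -> (multiplier_norm w <= M%:E)%E).
Proof.
move=> smooth [adm _] eps0 delta0 Lv yode y0 decrease.
pose l t := (along (cost_x P) xb ub t *m y t + along (cost_u P) xb ub t *m v t) 0 0.
have bound w : multiplier_tuple P xb ub w ->
    int01 (mz w) + fine (mzeta w I01) <= lam0 w / delta * int01 (fun t => `|l t|).
  move=> mw; rewrite mulrAC ler_pdivlMr// mulrC.
  exact: (multiplier_bound smooth adm mw eps0 Lv yode y0 decrease).
split=> [w mw|].
  split; first exact: (multiplier_lam0_gt0 smooth adm mw eps0 Lv yode y0 delta0 decrease).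
  have Ll : L1 l := bounded01_L1 (cost_direction_bounded01 smooth adm Lv yode).
  rewrite (L1_normE Ll : (\int[@Leb R]_(t in I01) `|(l t)%:E|)%E = _).
  by rewrite (L1_norm_mz mw) -(fineK (zeta_fin w)) -EFinD -EFinM lee_fin bound.
(* This [B] is the right-hand side of the estimate at [lam0 w = 1], and thus free of the tuple. *)
have [M HM] := multiplier_norm_bound smooth adm (1 / delta * int01 (fun t => `|l t|)).
by exists M => w mw l0; apply: HM => //; rewrite -l0 bound.
Qed.
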